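(* Let $v:\Omega_T\to\mathbb{R}$ be in $C^{2,1}(\Omega_T)$. Then for every $(x,t)\in\Omega_T$, as $\varepsilon\to 0^+$, $$\frac{n+2}{p+n}\,\frac{1}{|B_\varepsilon(x)|}\int_{B_\varepsilon(x)}v(y,t-\varepsilon^2)\,dy+\frac{p-2}{p+n}\sup_{|\sigma|=1}\left[\frac{v(x+\varepsilon\sigma,t-\varepsilon^2)+v(x-\varepsilon\sigma,t-\varepsilon^2)}{2}\right]$$ $$=v(x,t)+\frac{\varepsilon^2}{2(n+p)}\bigl(\mathcal{D}_p v(x,t)-2(n+p)v_t(x,t)\bigr)+o(\varepsilon^2).$$
   Context: Here $2<p<\infty$, $T>0$, $\Omega\subset\mathbb{R}^n$ is a bounded domain satisfying a uniform exterior sphere condition (there is $\delta>0$ such that for every $y\in\partial\Omega$ there is an open ball $B_\delta\subset\mathbb{R}^n\setminus\Omega$ of radius $\delta$ with $\overline{B}_\delta\cap\overline{\Omega}=\{y\}$), and $\Omega_T:=\Omega\times(0,T)$. $C^{2,1}(\Omega_T)$ denotes functions that are twice continuously differentiable in $x$ and once continuously differentiable in $t$. $B_\varepsilon(x)\subset\mathbb{R}^n$ is the ball of center $x$ and radius $\varepsilon$; the supremum is over all unit vectors $\sigma\in\mathbb{R}^n$. The dominative $p$-Laplacian is $\mathcal{D}_pv:=(\lambda_1+\dots+\lambda_{n-1})+(p-1)\lambda_n=\Delta v+(p-2)\lambda_n$, where $\lambda_1\le\dots\le\lambda_n$ are the eigenvalues of the Hessian $D^2v$ in the spatial variables. *)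

(* Defs.v *)
From HB Require Import structures.
From mathcomp Require Import all_boot all_order all_algebra.
From mathcomp Require Import all_classical all_reals all_analysis.
From mathcomp Require Import measurable_realfun.
From mathcomp Require Import complex.

Set Implicit Arguments.
Unset Strict Implicit.
Unset Printing Implicit Defensive.

Import Order.TTheory GRing.Theory Num.Theory.
Import numFieldNormedType.Exports.

Local Open Scope classical_set_scope.
Local Open Scope ring_scope.

Definition borel_rV_display : measure_display. Proof. by []. Qed.

Section borel_rV.
Variables (R : realType) (n : nat).

Definition borel_rV : set (set 'rV[R]_n) := <<s @open 'rV[R]_n >>.

Let borel_rV0 : borel_rV set0.
Proof. exact: sigma_algebra0. Qed.

Let borel_rVC A : borel_rV A -> borel_rV (~` A).
Proof. exact: sigma_algebraC. Qed.

Let borel_rV_bigcup (F : (set 'rV[R]_n)^nat) :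
  (forall i, borel_rV (F i)) -> borel_rV (\bigcup_i F i).
Proof. exact: sigma_algebra_bigcup. Qed.

HB.instance Definition _ := @isMeasurable.Build borel_rV_display 'rV[R]_n
  borel_rV borel_rV0 borel_rVC borel_rV_bigcup.

Lemma open_measurable_rV (U : set 'rV[R]_n) : open U -> measurable U.
Proof. by move=> oU; exact: sub_sigma_algebra. Qed.

End borel_rV.

(** n-dimensional Lebesgue measure, as the n-fold product of the Lebesgue
    measure of R, transported along R x R^n ~ R^(n+1). *)

Section lebesgue_rV.
Variable R : realType.

Definition cons_rV n (z : measurableTypeR R * 'rV[R]_n) : 'rV[R]_n.+1 :=
  row_mx (z.1%:M : 'rV[R]_1) z.2.

Lemma cons_rV0 n z : @cons_rV n z ord0 ord0 = z.1.
Proof.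
have -> : ord0 = lshift n (ord0 : 'I_1) :> 'I_n.+1 by exact/val_inj.
by rewrite [LHS]row_mxEl mxE eqxx.
Qed.

Lemma cons_rVS n z i : @cons_rV n z ord0 (lift ord0 i) = z.2 ord0 i.
Proof.
have -> : lift ord0 i = rshift 1 i :> 'I_n.+1 by exact/val_inj.
by rewrite [LHS]row_mxEr.
Qed.

Lemma open_bigcup_ball_rat n (U : set 'rV[R]_n) : open U ->
  U = \bigcup_(qk in [set qk : 'rV[rat]_n * nat |
         ball (map_mx ratr qk.1 : 'rV[R]_n) qk.2.+1%:R^-1 `<=` U])
       ball (map_mx ratr qk.1 : 'rV[R]_n) qk.2.+1%:R^-1.
Proof.
move=> oU; apply/seteqP; split => [x Ux|x [qk /= sU] /sU//].
have /nbhs_ballP[e /= e0 xeU] : nbhs x U by exact: open_nbhs_nbhs.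
have [k ke] : exists k : nat, k.+1%:R^-1 < e / 2.
  have e20 : 0 < e / 2 by rewrite divr_gt0.
  exists (Num.trunc (e / 2)^-1).
  rewrite invf_plt ?posrE//.
  exact: truncnS_gt.
have k0 : 0 < k.+1%:R^-1 :> R by rewrite invr_gt0.
have /choice[q qx] : forall i : 'I_n, exists q : rat,
    `|ratr q - x ord0 i| < k.+1%:R^-1 :> R.
  move=> i; have /rat_in_itvoo[q] : x ord0 i < x ord0 i + k.+1%:R^-1.
    by rewrite ltrDl.
  rewrite in_itv/= => /andP[xq qx]; exists q.
  by rewrite ger0_norm ?subr_ge0 1?ltW// ltrBlDl.
have xball : ball (map_mx ratr (\row_i q i) : 'rV[R]_n) k.+1%:R^-1 x.
  split => // i j; rewrite (ord1 i) !mxE; exact: qx.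
exists (\row_i q i, k) => //= y yq; apply: xeU.
apply: (@le_ball _ _ _ (k.+1%:R^-1 + k.+1%:R^-1)).
  by rewrite (splitr e) ltW// ltrD.
apply: ball_triangle yq; exact: ball_sym.
Qed.

Lemma cons_rV_ball n (q : 'rV[R]_n.+1) e : 0 < e ->
  @cons_rV n @^-1` ball q e =
  (ball (q ord0 ord0) e : set R) `*` ball (\row_i q ord0 (lift ord0 i)) e.
Proof.
move=> e0; apply/seteqP; split => [z [_ qz]|z [/= qz1 [_ qz2]]].
  split => /=; first by rewrite -(cons_rV0 z); exact: qz.
  by split => // i j; rewrite (ord1 i) mxE -cons_rVS; exact: qz.
split => // i j; rewrite (ord1 i); case: (unliftP ord0 j) => [k|] ->.
  by rewrite cons_rVS; have := qz2 ord0 k; rewrite mxE.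
by rewrite cons_rV0.
Qed.

Lemma measurable_cons_rV n : measurable_fun setT (@cons_rV n).
Proof.
apply: (measurability (@open 'rV[R]_n.+1)) => //.
move=> _ [U oU <-]; rewrite setTI [X in _ @^-1` X](open_bigcup_ball_rat oU).
rewrite preimage_bigcup bigcup_mkcond.
apply: countable_bigcupT_measurable => // -[q k].
case: ifPn => // _; rewrite cons_rV_ball ?invr_gt0//.
apply: measurableX; first exact: measurable_ball.
by apply: open_measurable_rV; exact: ball_open.
Qed.

Section lebesgue_rVS.
Variables (n : nat) (mu : {sigma_finite_measure set 'rV[R]_n -> \bar R}).
Local Open Scope ereal_scope.

Definition lebesgue_rVS : set 'rV[R]_n.+1 -> \bar R :=
  pushforward (lebesgue_measure \x mu) (@cons_rV n).

Let lebesgue_rVS0 : lebesgue_rVS set0 = 0.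
Proof. by rewrite /lebesgue_rVS /pushforward preimage_set0 measure0. Qed.

Let lebesgue_rVS_ge0 A : 0 <= lebesgue_rVS A.
Proof. by rewrite /lebesgue_rVS /pushforward measure_ge0. Qed.

Let lebesgue_rVS_semi_sigma_additive : semi_sigma_additive lebesgue_rVS.
Proof.
move=> F mF tF mUF; rewrite /lebesgue_rVS /pushforward preimage_bigcup.
apply: measure_semi_sigma_additive.
- by move=> k; rewrite -[X in measurable X]setTI; exact: measurable_cons_rV.
- apply/trivIsetP => /= i j _ _ ij; rewrite -preimage_setI.
  by move/trivIsetP : tF => /(_ _ _ _ _ ij) ->//; rewrite preimage_set0.
- rewrite -preimage_bigcup -[X in measurable X]setTI.
  exact: measurable_cons_rV.
Qed.

HB.instance Definition _ := isMeasure.Build _ _ _ lebesgue_rVS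
  lebesgue_rVS0 lebesgue_rVS_ge0 lebesgue_rVS_semi_sigma_additive.

Definition uncons_rV (x : 'rV[R]_n.+1) : measurableTypeR R * 'rV[R]_n :=
  (x ord0 ord0, \row_i x ord0 (lift ord0 i)).

Lemma uncons_rVK : cancel uncons_rV (@cons_rV n).
Proof.
move=> x; apply/rowP => j; case: (unliftP ord0 j) => [k|] ->.
  by rewrite cons_rVS mxE.
by rewrite cons_rV0.
Qed.

Lemma cons_rVK : cancel (@cons_rV n) uncons_rV.
Proof.
move=> z; rewrite /uncons_rV cons_rV0 [z in RHS]surjective_pairing; congr pair.
by apply/rowP => j; rewrite mxE cons_rVS.
Qed.

Lemma measurable_coord_rV k (i : 'I_k) :
  measurable_fun setT (fun x : 'rV[R]_k => x ord0 i : measurableTypeR R).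
Proof.
apply: (measurability _ (RGenOpens.measurableE R)).
move=> _ [_ [a [b ->]] <-]; rewrite setTI; apply: open_measurable_rV.
apply: open_comp; last exact: interval_open.
by move=> x _; exact: coord_continuous.
Qed.

Lemma measurable_uncons_rV : measurable_fun setT uncons_rV.
Proof.
apply/measurable_fun_pairP; split => /=; first exact: measurable_coord_rV.
apply: (measurability (@open 'rV[R]_n)) => //.
move=> _ [U oU <-]; rewrite setTI; apply: open_measurable_rV.
apply: open_comp => // x _ A /nbhs_ballP[e /= e0 xA].
apply/nbhs_ballP; exists e => //= y [_ xy]; apply: xA; split => // i j.
by rewrite !mxE; exact: xy.
Qed.

Let lebesgue_rVS_sigma_finite : sigma_finite setT lebesgue_rVS.
Proof.
have /sigma_finiteP[F [TF ndF Foo]] := sigma_finiteT (@lebesgue_measure R).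
have /sigma_finiteP[G [TG ndG Goo]] := sigma_finiteT mu.
have mFG k : measurable (F k `*` G k).
  by apply: measurableX; [exact: (Foo k).1|exact: (Goo k).1].
exists (fun k => uncons_rV @^-1` (F k `*` G k)).
  rewrite -preimage_bigcup; apply/esym; rewrite -subTset => x _ /=.
  have [i _ Fi] : (\bigcup_i F i) (uncons_rV x).1 by rewrite -TF.
  have [j _ Gj] : (\bigcup_i G i) (uncons_rV x).2 by rewrite -TG.
  exists (maxn i j) => //; split.
    by move: Fi; apply/subsetPset/ndF/leq_maxl.
  by move: Gj; apply/subsetPset/ndG/leq_maxr.
move=> k; split.
  by rewrite -[X in measurable X]setTI; exact: measurable_uncons_rV.
rewrite /lebesgue_rVS /pushforward -comp_preimage.
rewrite (_ : _ \o _ = id); last by apply/funext => z; exact: cons_rVK.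
have [mF Fk] := Foo k; have [mG Gk] := Goo k.
by rewrite preimage_id product_measure1E// lte_mul_pinfty// ge0_fin_numE.
Qed.

HB.instance Definition _ := Measure_isSigmaFinite.Build _ _ _ lebesgue_rVS
  lebesgue_rVS_sigma_finite.

End lebesgue_rVS.

Fixpoint lebesgue_rV n : {sigma_finite_measure set 'rV[R]_n -> \bar R} :=
  match n with
  | 0 => \d_(0 : 'rV[R]_0)
  | m.+1 => lebesgue_rVS (lebesgue_rV m)
  end.

Lemma lebesgue_rV_box n (a b : 'I_n -> R) : (forall i, a i <= b i) ->
  lebesgue_rV n [set x | forall i, x ord0 i \in `[a i, b i]] =
  (\prod_(i < n) (b i - a i))%:E.
Proof.
elim: n a b => [|n IHn] a b ab.
  by rewrite /= diracE mem_set ?big_ord0// => -[].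
pose B : set 'rV[R]_n.+1 := [set x | forall i, x ord0 i \in `[a i, b i]].
pose B' : set 'rV[R]_n :=
  [set x | forall i : 'I_n, x ord0 i \in `[a (lift ord0 i), b (lift ord0 i)]].
have BE : @cons_rV n @^-1` B =
    (`[a ord0, b ord0]%classic : set (measurableTypeR R)) `*` B'.
  apply/seteqP; split => [z /= zab|z /= [z1 z2] i].
    split => [|i]; first by rewrite -(cons_rV0 z); exact: zab.
    by rewrite -cons_rVS; exact: zab.
  case: (unliftP ord0 i) => [k|] ->; first by rewrite cons_rVS; exact: z2.
  by rewrite cons_rV0.
transitivity ((lebesgue_measure \x lebesgue_rV n) (@cons_rV n @^-1` B))%E => //.
rewrite BE.
rewrite product_measure1E//.
- rewrite IHn// big_ord_recl EFinM; congr (_ * _)%E.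
  apply: etrans (lebesgue_measure_itv _) _; rewrite /= lte_fin.
  case: ltP => // ba0; suff -> : b ord0 = a ord0 by rewrite subrr.
  by apply/eqP; rewrite eq_le ba0 ab.
- rewrite [X in measurable X](_ : _ = \bigcap_(i in [set: 'I_n])
    (fun x : 'rV[R]_n => x ord0 i : measurableTypeR R) @^-1`
      `[a (lift ord0 i), b (lift ord0 i)]%classic).
    apply: fin_bigcap_measurable => // i _.
    by rewrite -[X in measurable X]setTI; exact: measurable_coord_rV.
  by apply/seteqP; split => [x xab i _|x xab i]; exact: xab.
Qed.

End lebesgue_rV.

(** The library norm on 'rV[R]_n is the sup norm; the Euclidean norm induces
    the same topology and the same bounded sets. *)

Section euclidean.
Variables (R : realType) (n : nat).
Implicit Types (x y : 'rV[R]_n) (Omega : set 'rV[R]_n).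

Definition enorm x : R := Num.sqrt (\sum_(i < n) x ord0 i ^+ 2).

Definition eball x (r : R) : set 'rV[R]_n := [set y | enorm (y - x) < r].

Definition usphere : set 'rV[R]_n := [set x | enorm x = 1].

Definition domain Omega := [/\ open Omega, connected Omega & Omega !=set0].

Definition uniform_exterior_sphere Omega :=
  exists2 delta : R, 0 < delta &
    forall y, (closure Omega `\` Omega°) y ->
      exists z, eball z delta `<=` ~` Omega /\
                closure (eball z delta) `&` closure Omega = [set y].

Definition ball_mean x (r : R) (f : 'rV[R]_n -> R) : R :=
  (fine (lebesgue_rV R n (eball x r)))^-1 *
  \int[lebesgue_rV R n]_(y in eball x r) f y.

End euclidean.

Section parabolic.
Variables (R : realType) (n : nat).
Implicit Types (v : 'rV[R]_n * R -> R) (z : 'rV[R]_n * R) (i j : 'I_n).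

Definition partial_t v z : R := derive1 (fun s => v (z.1, s)) z.2.

Definition partial_x i v z : R :=
  'D_(delta_mx ord0 i) (fun y => v (y, z.2)) z.1.

Definition derivable_t v z := derivable (fun s => v (z.1, s)) z.2 1.

Definition derivable_x i v z :=
  derivable (fun y => v (y, z.2)) z.1 (delta_mx ord0 i).

Definition hessian v z : 'M[R]_n :=
  \matrix_(i, j) partial_x j (partial_x i v) z.

(* Here z = (x, t); the derivatives are jointly continuous in (x, t). *)
Definition C21 (Q : set ('rV[R]_n * R)) v :=
  [/\ {within Q, continuous v},
      (forall z, Q z -> derivable_t v z) /\ {within Q, continuous (partial_t v)},
      forall i, (forall z, Q z -> derivable_x i v z) /\
                {within Q, continuous (partial_x i v)} &
      forall i j, (forall z, Q z -> derivable_x j (partial_x i v) z) /\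
                  {within Q, continuous (partial_x j (partial_x i v))}].

End parabolic.

Section eigenvalues.
Variables (R : realType) (n : nat).
Implicit Type A : 'M[R]_n.

(* Eigenvalues are repeated according to their algebraic multiplicity. *)
Definition eigenvalue_seq A (s : seq R) :=
  sorted <=%R s /\ char_poly A = \prod_(a <- s) ('X - a%:P).

Definition eigenvalues A : seq R := xget [::] (eigenvalue_seq A).

End eigenvalues.

Lemma char_poly_conj (F : fieldType) n (P A : 'M[F]_n) : P \in unitmx ->
  char_poly (invmx P *m A *m P) = char_poly A.
Proof.
move=> Pu; rewrite /char_poly.
have Pu' : map_mx polyC P \in unitmx by rewrite map_unitmx.
have -> : char_poly_mx (invmx P *m A *m P) =
  invmx (map_mx polyC P) *m char_poly_mx A *m map_mx polyC P.
  rewrite /char_poly_mx !map_mxM map_invmx mulmxBr mulmxBl.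
  by rewrite scalar_mxC mulmxKV.
rewrite !det_mulmx mulrC mulrA -det_mulmx mulmxV// det1 mul1r//.
Qed.

Lemma eigenvalues_symmetric (R : realType) n (A : 'M[R]_n) : A^T = A ->
  eigenvalue_seq A (eigenvalues A).
Proof.
move=> symA; apply: (@xgetPex _ [::] (eigenvalue_seq A)).
pose C : numClosedFieldType := complex.complex R.
pose f : {rmorphism R -> C} := complex.real_complex_def (Phant R).
pose A' := map_mx f A.
have hA : A' \is hermsymmx.
  rewrite is_hermitianmxE expr0 scale1r; apply/eqP/matrixP => i j.
  by rewrite !mxE -[in RHS]symA mxE conj_Creal// complex.complex_real.
have /hermitian_normalmx /orthomx_spectralP A'E := hA.
have /mxOverP spR := hermitian_spectral_diag_real hA.
pose s := [seq complex.Re (spectral_diag A' ord0 i) | i <- enum 'I_n].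
exists (sort <=%R s); split; first exact: sort_le_sorted.
apply: (map_poly_inj f); rewrite map_char_poly -/A' A'E.
rewrite char_poly_conj ?spectral_unit// char_poly_trig ?diag_mx_is_trig//.
rewrite (perm_big s)/=; last by rewrite perm_sort.
rewrite rmorph_prod /s big_map big_enum/=; apply: eq_bigr => i _.
rewrite rmorphB/= map_polyX map_polyC/= mxE eqxx mulr1n; congr (_ - _%:P).
by rewrite complex.RRe_real.
Qed.

(* The eigenvalues lambda_1, ..., lambda_n are numbered from 0 here. *)
Definition dominative_pLaplacian (R : realType) (n : nat) (p : R)
    (v : 'rV[R]_n * R -> R) (z : 'rV[R]_n * R) : R :=
  let lambda := eigenvalues (hessian v z) in
  \sum_(i < n.-1) lambda`_i + (p - 1) * lambda`_n.-1.

(* Main.v *)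
Require Import Defs.
From mathcomp Require Import all_boot all_order all_algebra.
From mathcomp Require Import all_classical all_reals all_analysis.
From mathcomp Require Import measurable_realfun fingroup perm complex ring lra.

Import Order.TTheory GRing.Theory Num.Theory.
Import numFieldNormedType.Exports.

Local Open Scope classical_set_scope.
Local Open Scope ring_scope.

Set Implicit Arguments.
Unset Strict Implicit.
Unset Printing Implicit Defensive.

(** Put s = t - eps^2 and let H be the Hessian of v at (x, t). Taylor's formula
    in space at time s, together with the joint continuity of the second
    derivatives at (x, t), gives, uniformly in |h| <= eps,

      v(x + h, s) = v(x, s) + Dv(x, s).h + (h.H h) / 2 + o(eps^2).

    The gradient is taken at time s, where it need not be close enough to the one
    at time t; but the linear term is odd in h, so it disappears both from the
    mean over the ball and from the symmetric average over +- eps sigma. What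
    remains of the two averages is

    - mean over the ball: v(x, s) + eps^2 tr H / (2 (n + 2)), since the mean of
      h_i h_j over the ball of radius eps is eps^2 / (n + 2) if i = j and 0
      otherwise (lemmas [Rintegral_coordM] and [ball_mean_quadratic]);
    - supremum: v(x, s) + eps^2 lambda_n / 2, since H is symmetric
      ([hessian_sym]) and the largest eigenvalue of a symmetric matrix is the
      maximum of its quadratic form on the unit sphere ([dominative_quad],
      [sup_approx]).

    The weights (n + 2) / (p + n) and (p - 2) / (p + n) add up to 1 and combine
    the two second-order terms into
    eps^2 (tr H + (p - 2) lambda_n) / (2 (n + p)), while
    v(x, s) = v(x, t) - eps^2 v_t(x, t) + o(eps^2) supplies the time derivative.

    The moments of the ball come from symmetry and scaling. Lebesgue measure is
    characterised by its values on closed boxes, and maps that permute, rescale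
    and translate the coordinates send boxes to boxes, so they multiply the
    measure by the modulus of their determinant ([lebesgue_rV_monomial]).
    Reflections and transpositions then annihilate the odd moments and make the
    n moments of h_i^2 equal. Their sum, the integral F of |h|^2 over the unit
    ball, is related to the volume V of that ball by comparing |h|^2 with 1 and
    q^2 on the shell 1 <= |h| < q and letting q decrease to 1: this gives
    (n + 2) F = n V ([shell_limit]). *)

(** * Quadratic forms and the largest eigenvalue *)

Section quadratic_form.
Local Open Scope sesquilinear_scope.
Variable R : realType.

Definition quad n (A : 'M[R]_n) (h : 'rV[R]_n) : R :=
  \sum_i \sum_j h ord0 i * h ord0 j * A i j.

Lemma quadE n (A : 'M[R]_n) h : quad A h = (h *m A *m h^T) ord0 ord0.
Proof.
rewrite mxE /quad exchange_big; apply: eq_bigr => j _ /=.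
rewrite !mxE mulr_suml; apply: eq_bigr => i _; rewrite mulrAC //.
Qed.

Lemma quadZ n (A : 'M[R]_n) c h : quad A (c *: h) = c ^+ 2 * quad A h.
Proof.
rewrite /quad mulr_sumr; apply: eq_bigr => i _; rewrite mulr_sumr.
by apply: eq_bigr => j _; rewrite !mxE; ring.
Qed.

Lemma usphere_sum_sqr n (s : 'rV[R]_n) : @usphere R n s ->
  \sum_i s ord0 i ^+ 2 = 1.
Proof.
move=> /(congr1 (fun a => a ^+ 2)); rewrite sqr_sqrtr ?expr1n//.
by apply: sumr_ge0 => i _; exact: sqr_ge0.
Qed.

Lemma eigenvalue_seq_trace n (A : 'M[R]_n) s : eigenvalue_seq A s ->
  size s = n /\ \sum_(a <- s) a = \tr A.
Proof.
move=> [_ sA].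
have szs : size s = n.
  by have := size_char_poly A; rewrite sA size_prod_XsubC => -[].
split => //; move: szs; case: n A sA => [|n] A sA szs.
  by rewrite (size0nil szs) big_nil /mxtrace big_ord0.
apply: oppr_inj; rewrite -char_poly_trace// -coefPn_prod_XsubC ?szs//.
by rewrite sA.
Qed.

(** Diagonalising A over the complex numbers by a unitary matrix writes quad A s
    as the sum of d_k |w_k|^2 with the |w_k|^2 adding up to |s|^2 = 1, and each
    d_k is a real root of the characteristic polynomial. *)
Lemma quad_le_root_char n (A : 'M[R]_n) (l : R) s : A^T = A ->
  (forall a, root (char_poly A) a -> a <= l) ->
  @usphere R n s -> quad A s <= l.
Proof.
move=> symA Al us.
pose C : numClosedFieldType := complex.complex R.
pose f : {rmorphism R -> C} := complex.real_complex_def (Phant R).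
have fR a : (f a)^* = f a by rewrite conj_Creal// complex.complex_real.
pose A' := map_mx f A.
have hA : A' \is hermsymmx.
  rewrite is_hermitianmxE expr0 scale1r; apply/eqP/matrixP => i j.
  by rewrite !mxE -[in RHS]symA mxE fR.
have /hermitian_normalmx /orthomx_spectralP A'E := hA.
have /mxOverP spR := hermitian_spectral_diag_real hA.
set P := spectralmx A' in A'E; set d := spectral_diag A' in A'E spR.
have PU : P \is unitarymx by exact: spectral_unitarymx.
(* The coordinates of s in the orthonormal eigenbasis. *)
pose w : 'rV[C]_n := map_mx f s *m invmx P.
have dl i : d ord0 i <= f l.
  have dE : f (complex.Re (d ord0 i)) = d ord0 i.
    exact: complex.RRe_real (spR _ _).
  rewrite -dE complex.lecR.
  apply: Al; rewrite -(mapf_root f) map_char_poly -/A' A'E.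
  rewrite char_poly_conj ?spectral_unit// char_poly_trig ?diag_mx_is_trig//.
  rewrite dE.
  rewrite /root horner_prod (bigD1 i)//= hornerXsubC mxE eqxx mulr1n subrr.
  by rewrite mul0r.
have wE : invmx P = (P ^t Num.Def.conjC) by exact: invmx_unitary.
have sC : (map_mx f s ^t Num.Def.conjC) = (map_mx f s)^T.
  by apply/matrixP => i j; rewrite !mxE fR.
have w2 : (w ^t Num.Def.conjC) = P *m (map_mx f s)^T.
  by rewrite /w trmx_mul map_mxM wE trmxCK sC.
rewrite -(complex.lecR (quad A s) l) -/(f _) quadE.
have -> : f ((s *m A *m s^T) ord0 ord0) = (w *m diag_mx d *m w ^t Num.Def.conjC) ord0 ord0.
  rewrite w2 /w !mulmxA -(mulmxA (map_mx f s)) -(mulmxA (map_mx f s)) -A'E.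
  by rewrite /A' map_trmx -!map_mxM [RHS]mxE.
have w1 : \sum_i w ord0 i * (w ord0 i)^* = 1.
  have -> : \sum_i w ord0 i * (w ord0 i)^* = (w *m w ^t Num.Def.conjC) ord0 ord0.
    by rewrite mxE; apply: eq_bigr => i _; rewrite !mxE.
  rewrite w2 /w mulmxA -(mulmxA _ (invmx P)) mulVmx ?spectral_unit// mulmx1.
  rewrite map_trmx -map_mxM mxE [X in f X](_ : _ = 1) ?rmorph1// mxE.
  by rewrite -[RHS](usphere_sum_sqr us); apply: eq_bigr => i _; rewrite mxE expr2.
rewrite mul_mx_diag mxE -[leRHS]mul1r -w1 mulr_suml; apply: ler_sum => i _.
rewrite !mxE mulrAC; apply: ler_wpM2l => //; exact: mul_conjC_ge0.
Qed.

Lemma quad_eigenvector n (A : 'M[R]_n) (a : R) : root (char_poly A) a ->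
  exists2 s, @usphere R n s & quad A s = a.
Proof.
rewrite -eigenvalue_root_char => /eigenvalueP[u uA u0].
have u2 : 0 < \sum_i u ord0 i ^+ 2.
  rewrite lt_def sumr_ge0 ?andbT; last by move=> i _; exact: sqr_ge0.
  apply: contra u0; rewrite psumr_eq0; last by move=> i _; exact: sqr_ge0.
  move=> /allP u0; apply/eqP/rowP => i; rewrite mxE.
  by apply/eqP; have := u0 i (mem_index_enum _); rewrite /= sqrf_eq0.
have e0 : 0 < enorm u by rewrite sqrtr_gt0.
have eE : enorm u ^+ 2 = \sum_i u ord0 i ^+ 2 by rewrite sqr_sqrtr// ltW.
exists ((enorm u)^-1 *: u).
  rewrite /usphere/= {1}/enorm.
  under eq_bigr do rewrite mxE exprMn.
  by rewrite -mulr_sumr -eE -exprMn mulVf ?gt_eqF// expr1n sqrtr1.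
rewrite quadZ quadE uA -scalemxAl mxE.
have -> : (u *m u^T) ord0 ord0 = enorm u ^+ 2.
  by rewrite eE mxE; apply: eq_bigr => i _; rewrite mxE expr2.
by rewrite mulrCA -exprMn mulVf ?gt_eqF// expr1n mulr1.
Qed.

(** All that is needed of the eigenvalues: the dominative expression depends on
    the spectrum only through the trace and the top eigenvalue, and the latter is
    the maximum of the quadratic form on the unit sphere. *)
Lemma dominative_quad n (A : 'M[R]_n) (p : R) : (0 < n)%N -> A^T = A ->
  let l := (eigenvalues A)`_n.-1 in
  [/\ \sum_(i < n.-1) (eigenvalues A)`_i + (p - 1) * l = \tr A + (p - 2) * l,
      forall s, @usphere R n s -> quad A s <= l &
      exists2 s, @usphere R n s & quad A s = l].
Proof.
move=> n0 symA l.
have eA := eigenvalues_symmetric symA.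
have [sz trE] := eigenvalue_seq_trace eA.
have [srt cA] := eA.
have rootE a : root (char_poly A) a = (a \in eigenvalues A).
  by rewrite cA root_prod_XsubC.
split.
- rewrite -trE (big_nth 0) sz big_mkord /l.
  case: n n0 A {symA eA sz trE srt cA rootE} @l => // n _ A.
  by rewrite /= big_ord_recr/=; ring.
- move=> s us; apply: (quad_le_root_char symA _ us) => a.
  rewrite rootE => ain; have /(nthP 0)[i ilt <-] := ain.
  rewrite sz in ilt.
  apply: (sorted_leq_nth le_trans le_refl) => //.
  + by rewrite inE sz.
  + by rewrite inE sz prednK.
  + by rewrite -ltnS prednK.
- apply: quad_eigenvector; rewrite rootE; apply: mem_nth.
  by rewrite sz prednK.
Qed.

End quadratic_form.

Lemma quad_dist (R : realType) n (A B : 'M[R]_n) (h : 'rV[R]_n) (k r : R) : 0 <= k ->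
  (forall i j, `|A i j - B i j| <= k) -> (forall i, `|h ord0 i| <= r) ->
  `|quad A h - quad B h| <= n%:R ^+ 2 * k * r ^+ 2.
Proof.
move=> k0 AB hr.
have -> : n%:R ^+ 2 * k * r ^+ 2 = \sum_(i < n) \sum_(j < n) r * r * k.
  by rewrite !sumr_const !card_ord -[RHS]mulr_natl -[_ *+ n in RHS]mulr_natl; ring.
rewrite /quad -sumrB; apply: le_trans (ler_norm_sum _ _ _) _.
apply: ler_sum => i _; rewrite -sumrB; apply: le_trans (ler_norm_sum _ _ _) _.
apply: ler_sum => j _; rewrite -mulrBr !normrM.
by apply: ler_pM => //; exact: ler_pM.
Qed.

(** * Second-order calculus along lines *)

Section directional_derivatives.
Variables (R : realType) (V : normedModType R).
Implicit Types (f d : V -> R) (x y u e : V).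

(** Reduces every question on a directional derivative to a function of one real
    variable: the two difference quotients are equal. *)
Lemma is_derive_line f y e (s a : R) :
  is_derive (y + s *: e) e f a <->
  is_derive s 1 (fun r => f (y + r *: e)) a.
Proof.
have E : (fun h => h^-1 *: ((f \o shift (y + s *: e)) (h *: e) - f (y + s *: e))) =
  (fun h : R => h^-1 *: (((fun r => f (y + r *: e)) \o shift s) (h *: (1 : R)) -
     f (y + s *: e))).
  apply/funext => h; rewrite /shift/=; congr (_ *: (f _ - _)).
  by rewrite [h *: (1 : R)]mulr1 scalerDl addrCA.
by split => -[]; rewrite /derivable /derive -?E => *; split;
  rewrite /derivable /derive -?E.
Qed.

Lemma is_derive_translate f y z e (a : R) :
  is_derive (y + z) e f a -> is_derive y e (fun w => f (w + z)) a.
Proof.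
have E : (fun h => h^-1 *: ((f \o shift (y + z)) (h *: e) - f (y + z))) =
  (fun h : R => h^-1 *: (((fun w => f (w + z)) \o shift y) (h *: e) - f (y + z))).
  by apply/funext => h; rewrite /shift/= addrA.
by case; rewrite /derivable /derive E => *; split.
Qed.

Lemma is_deriveZr f x e (c a : R) :
  is_derive x e f a -> is_derive x (c *: e) f (c * a).
Proof.
move=> fa; rewrite -[x]addr0 -[0 in X in _ + X](scale0r (c *: e)).
apply/is_derive_line.
rewrite (_ : (fun r => _) = (fun r => f (x + r *: e)) \o (fun r : R => c *: r)); last first.
  by apply/funext => r /=; rewrite !scalerA mulrC.
apply: is_derive_eq.
  apply: is_derive1_comp.
  apply/is_derive_line; rewrite scaler0 scale0r addr0; exact: fa.
by rewrite /= mulrC /GRing.scale /= mulr1.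
Qed.

Lemma MVT_line f d y e : (forall s : R, 0 <= s <= 1 ->
    is_derive (y + s *: e) e f (d (y + s *: e))) ->
  exists2 s : R, 0 <= s <= 1 & f (y + e) - f y = d (y + s *: e).
Proof.
move=> fd.
have fd' (s : R) : 0 <= s <= 1 ->
    is_derive s 1 (fun r => f (y + r *: e)) (d (y + s *: e)).
  by move=> s01; apply/is_derive_line; exact: fd.
have [||s s01 E] := @MVT R (fun r => f (y + r *: e)) (fun r => d (y + r *: e)) _ _ ltr01.
- by move=> s /[!in_itv]/= /andP[s0 s1]; apply: fd'; rewrite !ltW.
- apply: derivable_within_continuous => s /[!in_itv]/= /fd' H.
  exact: ex_derive.
exists s; first by move: s01; rewrite in_itv/= => /andP[s0 s1]; rewrite !ltW.
by move: E; rewrite scale1r scale0r addr0 subr0 mulr1.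
Qed.

(** The inductive step from partial to directional derivatives. The increment
    along h (u + e) is the increment along h u, followed by an increment along
    h e that the mean value theorem turns into h times a value of d near x. So d
    has to be continuous at x, whereas the derivative along u enters through its
    value at x alone; this is what makes the step repeatable. *)
Lemma is_deriveDr f d x u e (a : R) :
  is_derive x u f a ->
  (\forall y \near x, is_derive y e f (d y)) -> {for x, continuous d} ->
  is_derive x (u + e) f (a + d x).
Proof.
move=> [fu fua] fe cd.
suff H : h^-1 *: ((f \o shift x) (h *: (u + e)) - f x) @[h --> 0^'] --> a + d x.
  by split; [exact: cvgP H|exact: cvg_lim H].
have -> : (fun h : R => h^-1 *: ((f \o shift x) (h *: (u + e)) - f x)) =
  (fun h : R => h^-1 *: ((f \o shift x) (h *: u) - f x) +
     h^-1 *: (f ((h *: u + x) + h *: e) - f (h *: u + x))).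
  apply/funext => h /=; rewrite -scalerDr; congr (_ *: _).
  by rewrite scalerDr addrAC [RHS]addrC addrA subrK.
apply: cvgD; first by rewrite -fua; exact: fu.
apply/cvgrPdist_le => eps eps0.
have : \forall y \near x, is_derive y e f (d y) /\ `|d x - d y| <= eps.
  near=> y; split; first by near: y.
  by near: y; move/cvgrPdist_le : cd; exact.
move=> /nbhs_ballP[r /= r0 xr].
have M0 : 0 < `|u| + `|e| + 1 by rewrite ltr_wpDl// addr_ge0.
near=> h.
have h0 : h != 0 by near: h; exact: nbhs_dnbhs_neq.
have hr : `|h| < r / (`|u| + `|e| + 1).
  near: h; apply: dnbhs0_lt; exact: divr_gt0.
have inr (s : R) : 0 <= s <= 1 -> ball x r (h *: u + x + s *: (h *: e)).
  move=> /andP[s0 s1]; rewrite -ball_normE/= (addrC _ x) -addrA opprD addNKr normrN.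
  apply: le_lt_trans (ler_normD _ _) _; rewrite !normrZ (ger0_norm s0).
  rewrite ltr_pdivlMr// in hr; apply: le_lt_trans hr.
  rewrite -addrA mulrDr lerD2l// mulrDr mulr1 -[leRHS]addr0.
  apply: (@le_trans _ _ (`|h| * `|e|)); last by rewrite addr0 lerDl.
  by rewrite ler_piMl// mulr_ge0.
have [|s s01 ->] := @MVT_line f (fun y => h * d y) (h *: u + x) (h *: e).
  by move=> s s01; apply: is_deriveZr; exact: (xr _ (inr _ s01)).1.
rewrite [_ *: _]mulKf//; exact: (xr _ (inr _ s01)).2.
Unshelve. all: by end_near.
Qed.

End directional_derivatives.

(** Rolle's theorem applied to f s - s f1 0 - s^2 M, where M makes the values at
    0 and 1 equal, and then the mean value theorem for f1. *)
Lemma taylor2_lagrange (R : realType) (f f1 f2 : R -> R) :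
  (forall s : R, 0 <= s <= 1 -> is_derive s 1 f (f1 s)) ->
  (forall s : R, 0 <= s <= 1 -> is_derive s 1 f1 (f2 s)) ->
  exists2 s : R, 0 <= s <= 1 & f 1 = f 0 + f1 0 + f2 s / 2.
Proof.
move=> ff1 f12.
pose M := f 1 - f 0 - f1 0.
pose g (s : R) := f s - s * f1 0 - s ^+ 2 * M.
have dg (s : R) : 0 <= s <= 1 -> is_derive s 1 g (f1 s - f1 0 - 2 * s * M).
  move=> s01; have := ff1 _ s01 => dfs.
  have -> : g = f - f1 0 *: (@id R) - M *: (@id R) ^+ 2.
    by apply/funext => z; rewrite /g !fctE /GRing.scale/=; ring.
  apply: is_derive_eq; rewrite /GRing.scale/= expr1; ring.
have cg (h dh : R -> R) (b : R) : b <= 1 ->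
    (forall s : R, 0 <= s <= 1 -> is_derive s 1 h (dh s)) ->
    {within `[0, b], continuous h}.
  move=> b1 hh; apply: derivable_within_continuous => s /[!in_itv]/= /andP[s0 sb].
  by have H : is_derive s 1 h (dh s) by apply: hh; rewrite s0 (le_trans sb).
have [||c c01 E] := @MVT R g (fun s => f1 s - f1 0 - 2 * s * M) _ _ ltr01.
- by move=> s /[!in_itv]/= /andP[s0 s1]; apply: dg; rewrite !ltW.
- exact: cg (lexx _) dg.
move: c01; rewrite in_itv/= => /andP[c0 c1].
have [||s s0c E1] := @MVT R f1 f2 _ _ c0.
- move=> s /[!in_itv]/= /andP[s0 sc]; apply: f12.
  by rewrite ltW//= ltW// (lt_trans sc).
- exact: cg (ltW c1) f12.
exists s.
  by move: s0c; rewrite in_itv/= => /andP[s0 sc]; rewrite ltW//= ltW// (lt_trans sc).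
have M2 : 2 * M = f2 s.
  apply: (mulIf (lt0r_neq0 c0)); move: E1; rewrite subr0 => <-.
  have H : f1 c - f1 0 - 2 * c * M = 0.
    by rewrite subr0 mulr1 in E; rewrite -E /g /M; ring.
  by apply/eqP; rewrite -subr_eq0 -oppr_eq0; apply/eqP; rewrite -[RHS]H; ring.
by rewrite -M2 /M; field.
Qed.

Section second_order.
Variables (R : realType) (n : nat).
Implicit Types (f : 'rV[R]_n -> R) (x y h : 'rV[R]_n) (U : set 'rV[R]_n).
Local Notation e i := (delta_mx ord0 i : 'rV[R]_n).

(** The coordinates of h are added one at a time with [is_deriveDr]. *)
Lemma is_derive_partials f (d : 'I_n -> 'rV[R]_n -> R) x h :
  (forall i, \forall y \near x, is_derive y (e i) f (d i y)) ->
  (forall i, {for x, continuous (d i)}) ->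
  is_derive x h f (\sum_i h ord0 i * d i x).
Proof.
move=> fd cd; rewrite {1}[h]row_sum_delta.
elim: (index_enum _) => [|i s IH].
  by rewrite !big_nil; exact: is_derive0.
rewrite !big_cons addrC [X in is_derive _ _ _ X]addrC.
apply: (@is_deriveDr _ _ f (fun y => h ord0 i * d i y)) => //.
  by apply: filterS (fd i) => y; exact: is_deriveZr.
by apply: continuousM; [exact: cst_continuous|exact: cd].
Qed.

(** [d i] is the i-th partial derivative of f, and [d2 i j] is its derivative
    along the j-th coordinate. Naming the derivatives lets the time variable stay
    frozen inside them. *)
Definition C2_derivatives U f (d : 'I_n -> 'rV[R]_n -> R)
    (d2 : 'I_n -> 'I_n -> 'rV[R]_n -> R) :=
  [/\ open U,
      forall y i, U y -> is_derive y (e i) f (d i y),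
      forall y i j, U y -> is_derive y (e j) (d i) (d2 i j y),
      forall y i, U y -> {for y, continuous (d i)} &
      forall y i j, U y -> {for y, continuous (d2 i j)}].

Lemma taylor2 U f d d2 x h : C2_derivatives U f d d2 ->
  (forall s : R, 0 <= s <= 1 -> U (x + s *: h)) ->
  exists2 s : R, 0 <= s <= 1 &
    f (x + h) = f x + \sum_i h ord0 i * d i x +
      quad (\matrix_(i, j) d2 i j (x + s *: h)) h / 2.
Proof.
move=> [oU df dd cd cd2] xU.
have nU y : U y -> \forall z \near y, U z by move=> Uy; exact: open_nbhs_nbhs.
have [||s s01 E] := @taylor2_lagrange R (fun s => f (x + s *: h))
  (fun s => \sum_i h ord0 i * d i (x + s *: h))
  (fun s => \sum_i \sum_j h ord0 i * h ord0 j * d2 i j (x + s *: h)).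
- move=> s /xU Us; apply/(is_derive_line f x h s); apply: is_derive_partials => i.
    by apply: filterS (nU _ Us) => y Uy; exact: df.
  exact: cd.
- move=> s /xU Us.
  rewrite (_ : (fun _ => _) = \sum_i (h ord0 i) *: (fun s => d i (x + s *: h))); last first.
    by apply/funext => r; rewrite fct_sumE.
  apply: is_derive_eq.
    apply: is_derive_sum => i; apply: is_deriveZ.
    apply/(is_derive_line (d i) x h s); apply: is_derive_partials => j.
      by apply: filterS (nU _ Us) => y Uy; exact: dd.
    exact: cd2.
  apply: eq_bigr => i _; rewrite [LHS]mulr_sumr; apply: eq_bigr => j _.
  by rewrite mulrA.
exists s => //; move: E; rewrite scale1r !scale0r !addr0 => ->; congr (_ + _ / _).
by apply: eq_bigr => i _; apply: eq_bigr => j _; rewrite mxE.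
Qed.

(** The mean value theorem, first along e i for the difference of f between two
    lines parallel to e i, and then along e j for [d i]. The left-hand side is
    symmetric in i and j, which is the source of Schwarz's theorem below. *)
Lemma second_difference_mvt U f d d2 x i j (r : R) : C2_derivatives U f d d2 -> 0 < r ->
  (forall a b : R, 0 <= a <= r -> 0 <= b <= r ->
    U (x + a *: e i + b *: e j)) ->
  exists2 ab : R * R, (0 <= ab.1 <= r) && (0 <= ab.2 <= r) &
    f (x + r *: e i + r *: e j) - f (x + r *: e i) - (f (x + r *: e j) - f x)
    = r ^+ 2 * d2 i j (x + ab.1 *: e i + ab.2 *: e j).
Proof.
move=> [oU df dd cd cd2] r0 xU.
have sr (s : R) : 0 <= s <= 1 -> 0 <= s * r <= r.
  by move=> /andP[s0 s1]; rewrite mulr_ge0 ?(ltW r0)//= ler_piMl// ltW.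
have rr : 0 <= r <= r by rewrite lexx ltW.
have r00 : 0 <= (0 : R) <= r by rewrite lexx ltW.
pose g y := f (y + r *: e j) - f y.
have [|s s01 Es] := @MVT_line R _ g (fun y => r * (d i (y + r *: e j) - d i y))
    x (r *: e i).
  move=> s /sr s01; apply: is_deriveZr; rewrite scalerA; apply: is_deriveB.
    by apply: is_derive_translate; apply: df; exact: xU.
  by apply: df; have := xU _ _ s01 r00; rewrite scale0r addr0.
have [|q q01 Eq] := @MVT_line R _ (d i) (fun y => r * d2 i j y)
    (x + s *: (r *: e i)) (r *: e j).
  move=> q q01; apply: is_deriveZr; apply: dd; rewrite !scalerA; apply: xU.
    exact: sr.
  exact: sr.
exists (s * r, q * r); first by rewrite /= !sr.
rewrite -[LHS]/(g (x + r *: e i) - g x) Es Eq /= -!scalerA mulrA expr2 //.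
Qed.

(** Schwarz's theorem. At scale q the second difference of f equals q^2 times
    [d2 i j] at one point close to x and q^2 times [d2 j i] at another one, and
    both functions are continuous at x. *)
Lemma second_partials_sym U f d d2 x i j : C2_derivatives U f d d2 -> U x ->
  d2 i j x = d2 j i x.
Proof.
move=> C2 Ux; have [oU df dd cd cd2] := C2.
apply/eqP; rewrite -subr_eq0 -normr_le0; apply/ler_addgt0Pr => eps eps0; rewrite add0r.
have : \forall y \near x, [/\ U y, `|d2 i j x - d2 i j y| <= eps / 2 &
    `|d2 j i x - d2 j i y| <= eps / 2].
  have e2 : 0 < eps / 2 by rewrite divr_gt0.
  near=> y; split; near: y; first exact: open_nbhs_nbhs.
    by have /cvgrPdist_le := cd2 x i j Ux; exact.
  by have /cvgrPdist_le := cd2 x j i Ux; exact.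
move=> /nbhs_ballP[r /= r0 xr].
pose q := r / (`|e i| + `|e j| + 1).
have M0 : 0 < `|e i| + `|e j| + 1 by rewrite ltr_wpDl// addr_ge0.
have q0 : 0 < q by exact: divr_gt0.
have inr (a b : R) : 0 <= a <= q -> 0 <= b <= q ->
    ball x r (x + a *: e i + b *: e j).
  move=> /andP[a0 aq] /andP[b0 bq].
  rewrite -ball_normE/= -addrA opprD addNKr normrN.
  apply: le_lt_trans (ler_normD _ _) _; rewrite !normrZ !ger0_norm//.
  have -> : r = q * `|e i| + q * `|e j| + q by rewrite /q; field; rewrite gt_eqF.
  by rewrite ltr_pwDr// lerD// ler_wpM2r.
have inr' (a b : R) : 0 <= a <= q -> 0 <= b <= q ->
    ball x r (x + a *: e j + b *: e i).
  by move=> aq bq; rewrite addrAC; exact: inr.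
have [|[a b] /= /andP[aq bq] Eab] := second_difference_mvt (x := x) (i := i) (j := j) C2 q0.
  by move=> a b aq bq; have [] := xr _ (inr _ _ aq bq).
have [|[a' b'] /= /andP[aq' bq'] Eab'] :=
    second_difference_mvt (x := x) (i := j) (j := i) C2 q0.
  by move=> a' b' aq' bq'; have [] := xr _ (inr' _ _ aq' bq').
(* Both sides are the second difference of f divided by q^2. *)
have E : d2 i j (x + a *: e i + b *: e j) = d2 j i (x + a' *: e j + b' *: e i).
  apply: (mulfI (lt0r_neq0 (exprn_gt0 2 q0))); rewrite -Eab -Eab'.
  by rewrite (addrAC x (q *: e j)); ring.
have [_ + _] := xr _ (inr _ _ aq bq); have [_ _] := xr _ (inr' _ _ aq' bq').
rewrite -E => H1 H2; rewrite (splitr eps).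
apply: le_trans (ler_distD (d2 i j (x + a *: e i + b *: e j)) _ _) _.
by rewrite lerD// distrC.
Unshelve. all: by end_near.
Qed.

End second_order.

(** * Change of variables for Lebesgue measure *)

Section boxes.
Variables (R : realType) (n : nat).
Implicit Types (a b : 'I_n -> R) (x : 'rV[R]_n).

Definition box a b : set 'rV[R]_n := [set x | forall i, x ord0 i \in `[a i, b i]].

(** The empty set is included so that the family is closed under intersection. *)
Definition boxes : set (set 'rV[R]_n) :=
  [set A | A = set0 \/ exists a b, (forall i, a i <= b i) /\ A = box a b].

Lemma boxes_setI : setI_closed boxes.
Proof.
move=> A B [->|[a [b [ab ->]]]]; first by rewrite set0I; left.
case=> [->|[c [d [cd ->]]]]; first by rewrite setI0; left.
pose l i := Num.max (a i) (c i); pose u i := Num.min (b i) (d i).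
have lu x : (box a b `&` box c d) x <-> box l u x.
  split=> [[xab xcd] i|xlu].
    have := xab i; have := xcd i; rewrite !in_itv/= => /andP[? ?] /andP[? ?].
    by rewrite ge_max le_min; apply/andP; split; apply/andP.
  by split=> i; have := xlu i; rewrite !in_itv/= ge_max le_min
    => /andP[/andP[? ?] /andP[? ?]]; apply/andP.
have [lub|lub] := pselect (forall i, l i <= u i).
  by right; exists l, u; split => //; apply/seteqP; split => x /lu.
left; apply/seteqP; split => // x /lu xlu; apply: lub => i.
by have := xlu i; rewrite in_itv/= => /andP[/le_trans]; exact.
Qed.

Lemma box_measurable a b : measurable (box a b).
Proof.
rewrite [X in measurable X](_ : _ = \bigcap_(i in [set: 'I_n])
  (fun x : 'rV[R]_n => x ord0 i : measurableTypeR R) @^-1` `[a i, b i]%classic).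
  apply: fin_bigcap_measurable => // i _.
  by rewrite -[X in measurable X]setTI; exact: measurable_coord_rV.
by apply/seteqP; split => [x xab i _|x xab i]; exact: xab.
Qed.

(** Cubes with rational centre and radius 1 / (k + 1): countably many of them
    suffice, which puts every open set into the sigma-algebra of the boxes. *)
Lemma open_bigcup_box_rat (U : set 'rV[R]_n) : open U ->
  U = \bigcup_(qk in [set qk : 'rV[rat]_n * nat |
         box (fun i => ratr (qk.1 ord0 i) - qk.2.+1%:R^-1)
             (fun i => ratr (qk.1 ord0 i) + qk.2.+1%:R^-1) `<=` U])
       box (fun i => ratr (qk.1 ord0 i) - qk.2.+1%:R^-1)
           (fun i => ratr (qk.1 ord0 i) + qk.2.+1%:R^-1).
Proof.
move=> oU; apply/seteqP; split => [x Ux|x [qk /= sU] /sU//].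
have /nbhs_ballP[e /= e0 xeU] : nbhs x U by exact: open_nbhs_nbhs.
have [k ke] : exists k : nat, k.+1%:R^-1 < e / 2.
  have e20 : 0 < e / 2 by rewrite divr_gt0.
  exists (Num.truncn (e / 2)^-1); rewrite invf_plt ?posrE//; exact: truncnS_gt.
set r : R := k.+1%:R^-1 in ke.
have r0 : 0 < r by rewrite invr_gt0.
have /choice[q qx] : forall i : 'I_n, exists q : rat,
    x ord0 i < ratr q < x ord0 i + r.
  move=> i; have /rat_in_itvoo[q] : x ord0 i < x ord0 i + r by rewrite ltrDl.
  by rewrite in_itv/=; exists q.
exists (\row_i q i, k); rewrite /= -/r; [move=> y yq|move=> i].
  apply: xeU; split => // i j; rewrite (ord1 i) /ball/= ltr_norml.
  have := yq j; have /andP[] := qx j; rewrite in_itv/= mxE.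
  move=> xq qr /andP[qy yqr]; lra.
by rewrite in_itv/= mxE; have /andP[] := qx i; lra.
Qed.

Lemma measurable_boxes : @measurable _ 'rV[R]_n = <<s boxes >>.
Proof.
apply/seteqP; split; last first.
  apply: smallest_sub; first exact: sigma_algebra_measurable.
  by move=> A [->//|[a [b [_ ->]]]]; exact: box_measurable.
apply: smallest_sub; first exact: smallest_sigma_algebra.
move=> U oU; rewrite (open_bigcup_box_rat oU) bigcup_mkcond.
apply: (@countable_bigcupT_measurable _ (g_sigma_algebraType boxes)) => // -[q k].
case: ifPn => // _; apply: sub_sigma_algebra; right; do 2 eexists.
split; last reflexivity.
by move=> i /=; rewrite lerD2l ge0_cp// invr_ge0.
Qed.

(** The closed boxes form an intersection-stable family that generates the Borel
    sets and exhausts the space by sets of finite measure, so a measure is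
    determined by its values on them. *)
Lemma lebesgue_rV_unique (mu : {measure set 'rV[R]_n -> \bar R}) :
  (forall a b, (forall i, a i <= b i) ->
     mu (box a b) = (\prod_(i < n) (b i - a i))%:E) ->
  forall A, measurable A -> mu A = lebesgue_rV R n A.
Proof.
move=> mu_box A mA; apply/esym.
pose cube k := box (fun=> - k%:R) (fun=> k%:R).
have cube_le k : forall i : 'I_n, - k%:R <= k%:R :> R.
  by move=> i; rewrite ge0_cp// ler0n.
apply: (measure_unique boxes cube) => //.
- exact: measurable_boxes.
- exact: boxes_setI.
- by move=> k; right; do 2 eexists; split; [exact: cube_le|reflexivity].
- apply/seteqP; split => // x _; exists (Num.truncn (\sum_i `|x ord0 i|)).+1 => //= i.
  rewrite in_itv/= -ler_norml; apply/ltW; apply: le_lt_trans (truncnS_gt _).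
  by rewrite (bigD1 i)//= lerDl sumr_ge0.
- move=> B [->|[a [b [ab ->]]]]; first by rewrite !measure0.
  by rewrite mu_box//; exact: lebesgue_rV_box.
- move=> k.
  exact: (eq_ind_r (fun z => z < +oo)%E (ltry _) (lebesgue_rV_box (cube_le k))).
Qed.

End boxes.

Section monomial_maps.
Variables (R : realType) (n : nat).
Implicit Types (a b c : 'I_n -> R) (s : {perm 'I_n}).

(** For nonzero c, the affine maps whose linear part is a monomial matrix (one
    nonzero entry in each row and column). Homotheties, reflections and coordinate
    permutations are of this form, and preimages of boxes are boxes. *)
Definition monomial_map s a c (y : 'rV[R]_n) : 'rV[R]_n :=
  \row_i (a i + c i * y ord0 (s i)).

(** Coordinate j = s i of the preimage is bounded by the solutions of
    a i + c i * y = l i and a i + c i * y = u i, whose order depends on the sign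
    of c i. *)
Lemma preimage_monomial_box s a c (l u : 'I_n -> R) : (forall i, c i != 0) ->
  (forall i, l i <= u i) ->
  let w i := `|c i|^-1 * (u i - l i) in
  exists l' u', [/\ forall i, l' i <= u' i,
    monomial_map s a c @^-1` box l u = box l' u' &
    \prod_i (u' i - l' i) = \prod_i w i].
Proof.
move=> c0 lu w.
have [l' [u' lu']] : exists l' u' : 'I_n -> R, forall j (i := (s^-1)%g j),
   [/\ l' j <= u' j, u' j - l' j = w i &
     forall y, (a i + c i * y \in `[l i, u i]) = (y \in `[l' j, u' j])].
  suff /choice[f fP] : forall j, exists p : R * R, let i := (s^-1)%g j in
      [/\ p.1 <= p.2, p.2 - p.1 = w i &
       forall y, (a i + c i * y \in `[l i, u i]) = (y \in `[p.1, p.2])].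
    by exists (fun j => (f j).1), (fun j => (f j).2) => j i; exact: fP.
  move=> j; set i := (s^-1)%g j; rewrite /w.
  have := c0 i; rewrite neq_lt => /orP[ci|ci].
    exists ((u i - a i) / c i, (l i - a i) / c i) => /=; split.
    - by rewrite ler_nM2r ?invr_lt0// lerD2r.
    - by rewrite ltr0_norm//; field; rewrite lt_eqF.
    - move=> y; rewrite !in_itv/= ler_ndivrMr// ler_ndivlMr// andbC.
      by rewrite lerBrDl lerBlDl (mulrC y).
  exists ((l i - a i) / c i, (u i - a i) / c i) => /=; split.
  - by rewrite ler_pM2r ?invr_gt0// lerD2r.
  - by rewrite gtr0_norm//; field; rewrite gt_eqF.
  - move=> y; rewrite !in_itv/= ler_pdivrMr// ler_pdivlMr//.
    by rewrite lerBrDl lerBlDl (mulrC y).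
exists l', u'; split => [j||]; first by have [] := lu' j.
- apply/seteqP; split => y /= ybox i.
    have [_ _ <-] := lu' i.
    by have := ybox ((s^-1)%g i); rewrite mxE permKV.
  have [_ _ E] := lu' (s i); rewrite mxE.
  by have := ybox (s i); rewrite -E permK.
- rewrite [RHS](reindex_inj (@perm_inj _ (s^-1)%g)); apply: eq_bigr => j _.
  by have [] := lu' j.
Qed.

Lemma measurable_monomial_map s a c : (forall i, c i != 0) ->
  measurable_fun setT (monomial_map s a c).
Proof.
move=> c0; apply: (measurability (@boxes R n)); first exact: measurable_boxes.
move=> _ [_ [->|[l [u [lu ->]]]] <-]; rewrite setTI.
  by rewrite preimage_set0; exact: measurable0.
by have [l' [u' [_ -> _]]] := preimage_monomial_box s a c0 lu; exact: box_measurable.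
Qed.

(** Both sides agree on boxes by [preimage_monomial_box]; [lebesgue_rV_unique]
    does the rest. *)
Lemma lebesgue_rV_monomial s a c (A : set 'rV[R]_n) : (forall i, c i != 0) ->
  measurable A ->
  (lebesgue_rV R n A =
    `|\prod_i c i|%:E * lebesgue_rV R n (monomial_map s a c @^-1` A))%E.
Proof.
move=> c0 mA; have mphi := measurable_monomial_map s a c0.
pose K := NngNum (normr_ge0 (\prod_i c i)).
rewrite -(@lebesgue_rV_unique R n
  (mscale K (pushforward (lebesgue_rV R n) (monomial_map s a c))))// => l u lu.
rewrite /mscale /= /pushforward.
have [l' [u' [lu' bE E]]] := preimage_monomial_box s a c0 lu.
transitivity (`|\prod_i c i|%:E * (\prod_i (u' i - l' i))%:E)%E.
  congr (_ * _)%E; rewrite -(lebesgue_rV_box lu').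
  by apply: (congr1 (lebesgue_rV R n)); exact: bE.
rewrite E -EFinM normr_prod -big_split; congr EFin; apply: eq_bigr => i _ /=.
by rewrite mulVKf// normr_eq0.
Qed.

End monomial_maps.

(** * Integrals of real-valued functions *)

Section real_integrable.
Context d (T : measurableType d) (R : realType) (mu : {measure set T -> \bar R}).
Variables (D : set T) (mD : measurable D).
Implicit Types f g : T -> R.

Lemma integrable_EFinD f g : mu.-integrable D (EFin \o f) ->
  mu.-integrable D (EFin \o g) -> mu.-integrable D (EFin \o (fun y => f y + g y)).
Proof.
move=> intf intg.
rewrite (_ : _ \o _ = (EFin \o f) \+ (EFin \o g))%E; first exact: integrableD.
by apply/funext => y.
Qed.

Lemma integrable_EFinZ k f : mu.-integrable D (EFin \o f) ->
  mu.-integrable D (EFin \o (fun y => k * f y)).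
Proof.
move=> intf; rewrite (_ : _ \o _ = (fun y => k%:E * (EFin \o f) y)%E).
  exact: integrableZl.
by apply/funext => y.
Qed.

Lemma integrable_EFin_sum (I : Type) (s : seq I) (f : I -> T -> R) :
  (forall i, mu.-integrable D (EFin \o f i)) ->
  mu.-integrable D (EFin \o (fun y => \sum_(i <- s) f i y)).
Proof.
move=> intf; rewrite (_ : _ \o _ = fun y => \sum_(i <- s) (f i y)%:E)%E.
  by apply: (integrable_sum mD) => i _; exact: intf.
by apply/funext => y /=; rewrite sumEFin.
Qed.

End real_integrable.

Lemma Rintegral_sum (R : realType) d (T : measurableType d)
    (mu : {measure set T -> \bar R}) (D : set T) (I : Type) (s : seq I) (f : I -> T -> R) :
  measurable D -> (forall i, mu.-integrable D (EFin \o f i)) ->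
  \int[mu]_(x in D) (\sum_(i <- s) f i x) = \sum_(i <- s) \int[mu]_(x in D) f i x.
Proof.
move=> mD intf; elim: s => [|i s IH].
  under eq_Rintegral do rewrite big_nil.
  by rewrite Rintegral_cst// mul0r big_nil.
under eq_Rintegral do rewrite big_cons.
by rewrite RintegralD// ?IH ?big_cons//; exact: integrable_EFin_sum.
Qed.

(** * Moments of Euclidean balls *)

Lemma eq_oppr0 (R : realType) (a : R) : a = - a -> a = 0.
Proof. by lra. Qed.

(** A polynomial that is nonnegative to the right of 1 is nonnegative at 1; this
    is how the limit of vanishing shells is taken. *)
Lemma horner1_ge0 (R : realType) (p : {poly R}) :
  (forall q : R, 1 < q -> 0 <= p.[q]) -> 0 <= p.[1].
Proof.
move=> p0; have c1 : p.[x] @[x --> (1 : R)^'+] --> p.[1].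
  by apply: cvg_at_right_filter; exact: continuous_horner.
rewrite -(cvg_lim _ c1)//; apply: limr_ge; first exact: cvgP c1.
by near=> q; apply: p0; near: q; exact: nbhs_right_gt.
Unshelve. all: by end_near.
Qed.

(** V and F stand for the volume of the unit ball and the integral of |y|^2 over
    it. All three terms are divisible by q - 1; after division, q = 1 turns the
    two inequalities into n V <= (n + 2) F <= n V. *)
Lemma shell_limit (R : realType) n (V F : R) :
  (forall q : R, 1 < q ->
    (q ^+ n - 1) * V <= (q ^+ (n + 2) - 1) * F <= q ^+ 2 * ((q ^+ n - 1) * V)) ->
  (n%:R + 2) * F = n%:R * V.
Proof.
move=> H; pose S m : {poly R} := \sum_(i < m) 'X^i.
have S1 m (q : R) : q ^+ m - 1 = (q - 1) * (S m).[q].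
  by rewrite subrX1 /S horner_sum; congr (_ * _); apply: eq_bigr => i _; rewrite hornerXn.
have Sn m : (S m).[1] = m%:R.
  rewrite /S horner_sum (eq_bigr (fun=> 1)) ?sumr_const ?card_ord// => i _.
  by rewrite hornerXn expr1n.
pose hE := (hornerD, hornerN, hornerM, hornerZ, hornerXn, hornerX).
have H1 : 0 <= (F *: S (n + 2)%N - V *: S n).[1].
  apply: horner1_ge0 => q q1; have /andP[+ _] := H q q1.
  rewrite !S1 -(pmulr_rge0 _ (_ : 0 < q - 1)) ?subr_gt0// !hE; lra.
have H2 : 0 <= ((V *: 'X^2) * S n - F *: S (n + 2)%N).[1].
  apply: horner1_ge0 => q q1; have /andP[_ +] := H q q1.
  rewrite !S1 -(pmulr_rge0 _ (_ : 0 < q - 1)) ?subr_gt0// !hE; lra.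
rewrite !hE !Sn natrD in H1 H2; lra.
Qed.

Section ball_moments.
Variables (R : realType) (n : nat).
Implicit Types (x y : 'rV[R]_n) (r : R) (i j : 'I_n) (s : {perm 'I_n}).
Local Notation L := (lebesgue_rV R n).

(** Stated for functions that are continuous on an open set only, because v is
    not assumed to be measurable outside of the cylinder. *)
Lemma continuous_measurable_rV (U : set 'rV[R]_n) (f : 'rV[R]_n -> R) :
  open U -> (forall y, U y -> {for y, continuous f}) -> measurable_fun U f.
Proof.
move=> oU cf; apply: (measurability _ (RGenOpens.measurableE R)).
move=> _ [_ [a [b ->]] <-]; apply: open_measurable_rV.
rewrite openE => y [Uy fy]; apply: filterI; first exact: open_nbhs_nbhs.
by apply: cf => //; apply: open_nbhs_nbhs; split => //; exact: interval_open.
Qed.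

Definition sqdist x y : R := \sum_i (y ord0 i - x ord0 i) ^+ 2.

Lemma sqdist_ge0 x y : 0 <= sqdist x y.
Proof. by apply: sumr_ge0 => i _; exact: sqr_ge0. Qed.

Lemma coord_le_sqdist x y i : (y ord0 i - x ord0 i) ^+ 2 <= sqdist x y.
Proof. by rewrite /sqdist (bigD1 i)//= lerDl sumr_ge0// => j _; exact: sqr_ge0. Qed.

Lemma eballE x r : 0 < r -> eball x r = [set y | sqdist x y < r ^+ 2].
Proof.
move=> r0; apply/seteqP; split => y; rewrite /eball/= /enorm;
  under eq_bigr do rewrite !mxE.
  by move=> H; rewrite -(sqr_sqrtr (sqdist_ge0 x y)) ltr_pXn2r ?nnegrE ?sqrtr_ge0// ltW.
by rewrite -/(sqdist x y) => H; rewrite -(ger0_norm (ltW r0)) -sqrtr_sqr ltr_sqrt// exprn_gt0.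
Qed.

Lemma coord_le_eball x r y i : 0 < r -> eball x r y ->
  `|y ord0 i - x ord0 i| <= r.
Proof.
move=> r0; rewrite eballE//= => /(le_lt_trans (coord_le_sqdist x y i)) /ltW H.
by rewrite -(ger0_norm (ltW r0)) -ler_sqr// -!normrX !ger0_norm// ?sqr_ge0.
Qed.

Lemma measurable_coordB x i (D : set 'rV[R]_n) :
  measurable_fun D (fun y => y ord0 i - x ord0 i).
Proof.
apply: measurable_funTS; apply: continuous_measurable_rV; first exact: openT.
by move=> y _; apply: continuousB; [exact: coord_continuous|exact: cst_continuous].
Qed.

Lemma measurable_sqdist x (D : set 'rV[R]_n) : measurable_fun D (sqdist x).
Proof.
by apply: measurable_sum => i; apply: measurable_funX; exact: measurable_coordB.
Qed.

Lemma measurable_eball x r : 0 < r -> measurable (eball x r).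
Proof.
move=> r0; rewrite eballE// -[X in measurable X]setTI.
rewrite (_ : [set _ | _] = sqdist x @^-1` `]-oo, r ^+ 2[%classic).
  by apply: measurable_sqdist => //; exact: measurable_itv.
by apply/seteqP; split => y /=; rewrite in_itv.
Qed.

Lemma le_lebesgue_rV (A B : set 'rV[R]_n) : measurable A -> measurable B ->
  A `<=` B -> (L A <= L B)%E.
Proof. by move=> mA mB; exact: (@le_measure _ _ _ L A B (mem_set mA) (mem_set mB)). Qed.

Lemma lebesgue_eball_lty x r : 0 < r -> (L (eball x r) < +oo)%E.
Proof.
move=> r0.
have xr i : x ord0 i - r <= x ord0 i + r by rewrite lerD2l ge0_cp// ltW.
apply: (@le_lt_trans _ _ (L (box (fun i => x ord0 i - r) (fun i => x ord0 i + r)))).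
  apply: le_lebesgue_rV (measurable_eball x r0) (box_measurable _ _) _.
  move=> y Ey i; have := coord_le_eball i r0 Ey.
  by rewrite in_itv/= ler_norml => /andP[? ?]; apply/andP; split; lra.
exact: (eq_ind_r (fun z => z < +oo)%E (ltry _) (lebesgue_rV_box xr)).
Qed.

(** The ball contains the cube of half-side r / (n + 1), as
    n / (n + 1)^2 < 1. *)
Lemma lebesgue_eball_gt0 x r : 0 < r -> (0 < L (eball x r))%E.
Proof.
move=> r0; pose d := r / n.+1%:R.
have d0 : 0 < d by rewrite divr_gt0.
have xd i : x ord0 i - d <= x ord0 i + d by rewrite lerD2l ge0_cp// ltW.
apply: (@lt_le_trans _ _ (L (box (fun i => x ord0 i - d) (fun i => x ord0 i + d)))).
  apply: (eq_ind_r (fun z => 0 < z)%E _ (lebesgue_rV_box xd)).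
  rewrite lte_fin; apply: prodr_gt0 => i _; lra.
apply: le_lebesgue_rV (box_measurable _ _) (measurable_eball x r0) _.
move=> y xy; rewrite eballE//=.
apply: (@le_lt_trans _ _ (\sum_(i < n) d ^+ 2)).
  apply: ler_sum => i _; have := xy i; rewrite in_itv/= => /andP[? ?].
  by rewrite -subr_ge0 subr_sqr mulr_ge0//; lra.
rewrite sumr_const card_ord -mulr_natl /d expr_div_n mulrCA -ltr_pdivlMl ?exprn_gt0//.
rewrite mulVf ?gt_eqF ?exprn_gt0// ltr_pdivrMr ?exprn_gt0// mul1r -natrX ltr_nat.
by rewrite expnS expn1; apply: (@leq_trans n.+1) => //; rewrite leq_pmulr.
Qed.

Definition vol x r : R := fine (L (eball x r)).

Lemma vol_gt0 x r : 0 < r -> 0 < vol x r.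
Proof.
by move=> r0; rewrite fine_gt0// lebesgue_eball_gt0//= lebesgue_eball_lty.
Qed.

Lemma integrable_eball x r (f : 'rV[R]_n -> R) (M : R) : 0 < r ->
  measurable_fun (eball x r) f -> (forall y, eball x r y -> `|f y| <= M) ->
  L.-integrable (eball x r) (EFin \o f).
Proof.
move=> r0 mf fM; apply: measurable_bounded_integrable => //.
- exact: measurable_eball.
- exact: lebesgue_eball_lty.
- exists M; split; first exact: num_real.
  by move=> N MN y Ey; exact: le_trans (fM _ Ey) (ltW MN).
Qed.

Lemma integrable_coordB x r i : 0 < r ->
  L.-integrable (eball x r) (EFin \o (fun y => y ord0 i - x ord0 i)).
Proof.
move=> r0; apply: (integrable_eball r0); first exact: measurable_coordB.
by move=> y; exact: coord_le_eball.
Qed.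

Lemma measurable_coordM x i j (D : set 'rV[R]_n) : measurable_fun D
  (fun y => (y ord0 i - x ord0 i) * (y ord0 j - x ord0 j)).
Proof. by apply: measurable_funM; exact: measurable_coordB. Qed.

Lemma integrable_coordM x r i j : 0 < r ->
  L.-integrable (eball x r)
    (EFin \o (fun y => (y ord0 i - x ord0 i) * (y ord0 j - x ord0 j))).
Proof.
move=> r0; apply: (integrable_eball (M := r * r) r0).
  exact: measurable_coordM.
by move=> y Ey; rewrite normrM ler_pM//; exact: coord_le_eball.
Qed.

Lemma integrable_sqdist x r : 0 < r ->
  L.-integrable (eball x r) (EFin \o sqdist x).
Proof.
move=> r0; apply: (integrable_eball (M := r ^+ 2) r0).
  exact: measurable_sqdist.
by move=> y; rewrite eballE//= => /ltW; rewrite ger0_norm// sqdist_ge0.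
Qed.

(** When the entries of c are signs, the signed permutation of the coordinates
    that fixes x. *)
Definition isometry_at x (s : {perm 'I_n}) (c : 'I_n -> R) :=
  monomial_map s (fun i => x ord0 i - c i * x ord0 (s i)) c.

Lemma isometry_atE x s c y i : isometry_at x s c y ord0 i - x ord0 i =
  c i * (y ord0 (s i) - x ord0 (s i)).
Proof. by rewrite mxE; ring. Qed.

Lemma preimage_isometry_eball x s c r : 0 < r -> (forall i, c i ^+ 2 = 1) ->
  isometry_at x s c @^-1` eball x r = eball x r.
Proof.
move=> r0 c1; rewrite eballE//; apply/seteqP.
suff E y : sqdist x (isometry_at x s c y) = sqdist x y by split=> y /=; rewrite E.
rewrite /sqdist [RHS](reindex_inj (@perm_inj _ s)); apply: eq_bigr => i _ /=.
by rewrite isometry_atE exprMn c1 mul1r.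
Qed.

Lemma Rintegral_eball_isometry x s c r (f : 'rV[R]_n -> R) : 0 < r ->
  (forall i, c i ^+ 2 = 1) -> measurable_fun setT f ->
  L.-integrable (eball x r) (EFin \o (f \o isometry_at x s c)) ->
  \int[L]_(y in eball x r) f y = \int[L]_(y in eball x r) f (isometry_at x s c y).
Proof.
move=> r0 c1 mf intf.
have c0 i : c i != 0 by rewrite -sqrf_eq0 c1 oner_eq0.
have mphi : measurable_fun setT (isometry_at x s c) by exact: measurable_monomial_map.
rewrite /Rintegral; congr fine.
transitivity (\int[pushforward L (isometry_at x s c)]_(y in eball x r) (f y)%:E)%E.
  apply: eq_measure_integral => A mA _; apply: etrans (lebesgue_rV_monomial s _ c0 mA) _.
  rewrite (_ : `|_| = 1) ?mul1e//; apply/eqP.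
  rewrite -sqrp_eq1// real_normK ?num_real// -prodrXl.
  by apply/eqP; rewrite big1.
have mE := measurable_eball x r0.
have mf' : measurable_fun setT (EFin \o f) by exact/measurable_EFinP.
have pE := preimage_isometry_eball x s r0 c1.
rewrite -[in RHS]pE; apply: (integral_pushforward mphi mf' _ mE).
by rewrite pE.
Qed.

Lemma Rintegral_coordB x r i : 0 < r ->
  \int[L]_(y in eball x r) (y ord0 i - x ord0 i) = 0.
Proof.
move=> r0.
suff E : \int[L]_(y in eball x r) (y ord0 i - x ord0 i) =
    - \int[L]_(y in eball x r) (y ord0 i - x ord0 i).
  exact: eq_oppr0 E.
have ic := integrable_coordB x i r0.
rewrite [LHS](@Rintegral_eball_isometry x 1%g (fun=> -1))//=.
- under eq_Rintegral do rewrite isometry_atE perm1.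
  by rewrite RintegralZl ?mulN1r//; exact: measurable_eball.
- by move=> _; rewrite sqrrN expr1n.
- exact: measurable_coordB.
- rewrite (_ : _ \o _ = (fun y => - (y ord0 i - x ord0 i)%:E))%E; last first.
    by apply/funext => y /=; rewrite isometry_atE perm1 mulN1r EFinN.
  exact: integrableN.
Qed.

Lemma Rintegral_coordM_isometry x s c r i j : 0 < r -> (forall i, c i ^+ 2 = 1) ->
  \int[L]_(y in eball x r) ((y ord0 i - x ord0 i) * (y ord0 j - x ord0 j)) =
  c i * c j * \int[L]_(y in eball x r)
    ((y ord0 (s i) - x ord0 (s i)) * (y ord0 (s j) - x ord0 (s j))).
Proof.
move=> r0 c1; have ic := integrable_coordM x (s i) (s j) r0.
have E y : (isometry_at x s c y ord0 i - x ord0 i) * (isometry_at x s c y ord0 j - x ord0 j) =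
    c i * c j * ((y ord0 (s i) - x ord0 (s i)) * (y ord0 (s j) - x ord0 (s j))).
  by rewrite !isometry_atE; ring.
rewrite [LHS](@Rintegral_eball_isometry x s c)//=.
- under eq_Rintegral do rewrite E.
  by rewrite RintegralZl//; exact: measurable_eball.
- exact: measurable_coordM.
- rewrite (_ : _ \o _ = (fun y => (c i * c j)%:E *
      ((y ord0 (s i) - x ord0 (s i)) * (y ord0 (s j) - x ord0 (s j)))%:E))%E; last first.
    by apply/funext => y /=; rewrite E EFinM.
  by apply: integrableZl => //; exact: measurable_eball.
Qed.

Lemma Rintegral_coordM0 x r i j : 0 < r -> i != j ->
  \int[L]_(y in eball x r) ((y ord0 i - x ord0 i) * (y ord0 j - x ord0 j)) = 0.
Proof.
move=> r0 ij; pose c k : R := if k == i then -1 else 1.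
have c1 k : c k ^+ 2 = 1 by rewrite /c; case: ifP => _; rewrite ?sqrrN expr1n.
have := Rintegral_coordM_isometry x 1%g i j r0 c1.
rewrite !perm1 /c eqxx eq_sym (negbTE ij) mulr1 mulN1r => E.
exact: eq_oppr0 E.
Qed.

Lemma Rintegral_coordM_eq x r i j : 0 < r ->
  \int[L]_(y in eball x r) ((y ord0 i - x ord0 i) * (y ord0 i - x ord0 i)) =
  \int[L]_(y in eball x r) ((y ord0 j - x ord0 j) * (y ord0 j - x ord0 j)).
Proof.
move=> r0; have c1 (k : 'I_n) : (1 : R) ^+ 2 = 1 by rewrite expr1n.
have := Rintegral_coordM_isometry x (tperm i j) i i r0 c1.
by rewrite !tpermL !mulr1 mul1r.
Qed.

(** For nonnegative integrands the extended-real integrals are proportional; if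
    they are infinite then both sides are 0. *)
Lemma Rintegral_eball_homothety x r (f : 'rV[R]_n -> R) : 0 < r ->
  measurable_fun setT f -> (forall y, 0 <= f y) ->
  \int[L]_(y in eball x r) f y =
  r ^+ n * \int[L]_(y in eball 0 1) f (x + r *: y).
Proof.
move=> r0 mf f0; have c0 (i : 'I_n) : r != 0 by rewrite gt_eqF.
pose phi := monomial_map 1%g (fun i => x ord0 i) (fun=> r).
have phiE y : phi y = x + r *: y.
  by apply/rowP => i; rewrite !mxE perm1.
have mphi : measurable_fun setT phi by exact: measurable_monomial_map.
pose K := NngNum (exprn_ge0 n (ltW r0)).
have mE := measurable_eball x r0.
have mf' : measurable_fun setT (EFin \o f) by exact/measurable_EFinP.
have pE : phi @^-1` eball x r = eball 0 1.
  rewrite !eballE//; apply/seteqP.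
  suff E y : (sqdist x (phi y) < r ^+ 2) = (sqdist 0 y < 1 ^+ 2).
    by split=> y /=; rewrite E.
  rewrite expr1n -[RHS](ltr_pM2l (exprn_gt0 2 r0)) mulr1; congr (_ < _).
  rewrite /sqdist mulr_sumr; apply: eq_bigr => i _.
  by rewrite phiE !mxE subr0 addrAC subrr add0r exprMn.
rewrite /Rintegral.
have -> : (\int[L]_(y in eball x r) (f y)%:E =
    (r ^+ n)%:E * \int[L]_(y in eball 0 1) (f (x + r *: y))%:E)%E.
  apply: (@etrans _ _
    (\int[mscale K (pushforward L phi)]_(y in eball x r) (f y)%:E)%E) => //.
    apply: eq_measure_integral => A mA _.
    apply: etrans (lebesgue_rV_monomial 1%g _ c0 mA) _.
    by rewrite prodr_const card_ord ger0_norm// exprn_ge0// ltW.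
  rewrite ge0_integral_mscale//; last 2 first.
  - exact: measurable_funTS.
  - by move=> y _; rewrite lee_fin.
  congr (_ * _)%E; rewrite -[in RHS]pE.
  apply: etrans (ge0_integral_pushforward mphi _ mE _ _) _.
  - exact: measurable_funTS.
  - by move=> y _; rewrite lee_fin.
  - by apply: eq_integral => y _; rewrite /= phiE.
have rn0 : 0 < r ^+ n by exact: exprn_gt0.
have : (0 <= \int[L]_(y in eball 0 1) (f (x + r *: y))%:E)%E.
  by apply: integral_ge0 => y _; rewrite lee_fin.
case: (integral _ _ _) => [a _|_|//]; first by rewrite -EFinM.
by rewrite gt0_muley ?lte_fin//= mulr0.
Qed.

Lemma vol_homothety x r : 0 < r -> vol x r = r ^+ n * vol 0 1.
Proof.
move=> r0.
have := @Rintegral_eball_homothety x r (cst 1) r0 _ (fun=> ler01).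
have m1 : measurable_fun [set: 'rV[R]_n] (cst (1 : R)) by exact: measurable_cst.
by move=> /(_ m1); rewrite !Rintegral_cst ?mul1r//; exact: measurable_eball.
Qed.

Lemma Rintegral_sqdist_homothety x r : 0 < r ->
  \int[L]_(y in eball x r) sqdist x y =
  r ^+ (n + 2) * \int[L]_(y in eball 0 1) sqdist 0 y.
Proof.
move=> r0.
rewrite (Rintegral_eball_homothety x r0 (@measurable_sqdist x setT) (sqdist_ge0 x)).
rewrite exprD -mulrA; congr (_ * _); rewrite -RintegralZl//.
- apply: eq_Rintegral => y _; rewrite /sqdist mulr_sumr; apply: eq_bigr => i _.
  by rewrite !mxE subr0 addrAC subrr add0r exprMn.
- exact: measurable_eball.
- exact: integrable_sqdist.
Qed.

(** On the shell between the radii 1 and q the integrand lies between 1 and q^2,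
    and by homogeneity the shell has volume (q^n - 1) V and second moment
    (q^(n + 2) - 1) F. *)
Lemma Rintegral_sqdist_shell (q : R) (V := vol (0 : 'rV[R]_n) 1)
    (F := \int[L]_(y in eball 0 1) sqdist 0 y) : 1 < q ->
  (q ^+ n - 1) * V <= (q ^+ (n + 2) - 1) * F <= q ^+ 2 * ((q ^+ n - 1) * V).
Proof.
move=> q1; have q0 : 0 < q by exact: lt_trans q1.
pose D : set 'rV[R]_n := eball 0 q `\` eball 0 1.
have mD : measurable D by apply: measurableD; exact: measurable_eball.
have mE := measurable_eball (0 : 'rV[R]_n) ltr01.
have E1q : eball (0 : 'rV[R]_n) 1 `|` D = eball 0 q.
  apply: setDUK => y; rewrite !eballE//= => /lt_trans; apply.
  by rewrite ltr_pXn2r ?nnegrE// ltW.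
have disj : [disjoint eball (0 : 'rV[R]_n) 1 & D].
  by apply/disj_setPS => y [? []].
have split_int f : L.-integrable (eball 0 q) (EFin \o f) ->
    \int[L]_(y in D) f y = \int[L]_(y in eball 0 q) f y - \int[L]_(y in eball 0 1) f y.
  move=> intf; rewrite -E1q in intf *.
  by rewrite Rintegral_setU// addrAC subrr add0r.
have DE f : L.-integrable (eball 0 q) f -> L.-integrable D f.
  by apply: integrableS => //; [exact: measurable_eball|move=> y []].
have intc (c : R) : L.-integrable (eball 0 q) (EFin \o cst c).
  by apply: (integrable_eball (M := `|c|) q0).
have intS := integrable_sqdist (0 : 'rV[R]_n) q0.
have VD (c : R) : \int[L]_(y in D) c = c * ((q ^+ n - 1) * V).
  rewrite (split_int (cst c))// !Rintegral_cst//; last exact: measurable_eball.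
  by rewrite -/(vol _ _) -/(vol _ _) vol_homothety// /V; ring.
have FD : \int[L]_(y in D) sqdist 0 y = (q ^+ (n + 2) - 1) * F.
  by rewrite split_int// Rintegral_sqdist_homothety// mulrBl mul1r.
rewrite -VD -[leLHS]mul1r -VD -FD.
apply/andP; split; apply: le_Rintegral => //; try exact: (DE (EFin \o cst _)); try exact: DE.
- by move=> y [_]; rewrite eballE//= => /negP; rewrite -leNgt expr1n.
- by move=> y [+ _]; rewrite eballE//= => /ltW.
Qed.

End ball_moments.

Section second_moments.
Variables (R : realType) (n : nat).
Implicit Types (x y : 'rV[R]_n) (r : R) (i j : 'I_n).
Local Notation L := (lebesgue_rV R n).

(** Off the diagonal a reflection changes the sign of the integrand. On it, the n
    integrals are equal by transposition of coordinates, and their sum is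
    the second moment, which [shell_limit] expresses through the volume. *)
Lemma Rintegral_coordM x r i j : 0 < r ->
  \int[L]_(y in eball x r) ((y ord0 i - x ord0 i) * (y ord0 j - x ord0 j)) =
  (i == j)%:R * (r ^+ 2 / (n%:R + 2) * vol x r).
Proof.
move=> r0; have [->|ij] := eqVneq i j; last first.
  by rewrite mul0r Rintegral_coordM0.
have n0 : (0 < n)%N by case: (n) j => // -[].
have n20 : n%:R + 2 != 0 :> R by rewrite gt_eqF// ltr_wpDl.
have nn0 : n%:R != 0 :> R by rewrite pnatr_eq0 -lt0n.
have S : \int[L]_(y in eball x r) sqdist x y = n%:R *
    \int[L]_(y in eball x r) ((y ord0 j - x ord0 j) * (y ord0 j - x ord0 j)).
  rewrite /sqdist Rintegral_sum; [|exact: measurable_eball|]; last first.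
    by move=> k; under [X in _ \o X]eq_fun do rewrite expr2; exact: integrable_coordM.
  rewrite (eq_bigr (fun=> \int[L]_(y in eball x r)
    ((y ord0 j - x ord0 j) * (y ord0 j - x ord0 j)))).
    by rewrite sumr_const card_ord mulr_natl.
  move=> k _; rewrite -(Rintegral_coordM_eq x k j r0).
  by apply: eq_Rintegral => y _; rewrite expr2.
have F := shell_limit (@Rintegral_sqdist_shell R n).
rewrite mul1r; apply: (mulfI nn0); rewrite -S Rintegral_sqdist_homothety//.
rewrite vol_homothety//; apply: (mulfI n20).
by rewrite mulrCA F exprD; field.
Qed.

End second_moments.

Section mean_value.
Variables (R : realType) (n : nat).
Implicit Types (x y : 'rV[R]_n).
Local Notation L := (lebesgue_rV R n).

Lemma Rintegral_quadratic x r (c : R) (b : 'I_n -> R) (A : 'M[R]_n)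
    (P := fun y => c + (\sum_i b i * (y ord0 i - x ord0 i) + quad A (y - x) / 2)) :
  0 < r ->
  [/\ measurable_fun setT P, L.-integrable (eball x r) (EFin \o P) &
     \int[L]_(y in eball x r) P y =
       vol x r * (c + \tr A * r ^+ 2 / (2 * (n%:R + 2)))].
Proof.
move=> r0; have mE := measurable_eball x r0.
have n20 : n%:R + 2 != 0 :> R by rewrite gt_eqF// ltr_wpDl.
pose lin i y := b i * (y ord0 i - x ord0 i).
pose qd i j y := A i j / 2 * ((y ord0 i - x ord0 i) * (y ord0 j - x ord0 j)).
have PE y : P y = c + (\sum_i lin i y + \sum_i \sum_j qd i j y).
  rewrite /P; congr (_ + (_ + _)); rewrite /quad mulr_suml.
  apply: eq_bigr => i _; rewrite mulr_suml; apply: eq_bigr => j _.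
  by rewrite !mxE /qd; ring.
have PE' : P = fun y => c + (\sum_i lin i y + \sum_i \sum_j qd i j y).
  exact/funext/PE.
have mlin i : measurable_fun setT (lin i).
  by apply: measurable_funM => //; exact: measurable_coordB.
have mqd i j : measurable_fun setT (qd i j).
  by apply: measurable_funM => //; exact: measurable_coordM.
have intc : L.-integrable (eball x r) (EFin \o cst c).
  by apply: (integrable_eball (M := `|c|) r0).
have ilin i : L.-integrable (eball x r) (EFin \o lin i).
  by apply: integrable_EFinZ => //; exact: integrable_coordB.
have iqd i j : L.-integrable (eball x r) (EFin \o qd i j).
  by apply: integrable_EFinZ => //; exact: integrable_coordM.
have iqd1 i : L.-integrable (eball x r) (EFin \o (fun y => \sum_j qd i j y)).
  exact: integrable_EFin_sum.
have ilins := integrable_EFin_sum mE (index_enum 'I_n) ilin.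
have iqds := integrable_EFin_sum mE (index_enum 'I_n) iqd1.
split.
- rewrite PE'.
  apply: measurable_funD => //; apply: measurable_funD; first exact: measurable_sum.
  by apply: measurable_sum => i; exact: measurable_sum.
- rewrite PE'.
  by apply: integrable_EFinD => //; exact: integrable_EFinD.
have lin0 i : \int[L]_(y in eball x r) lin i y = 0.
  rewrite RintegralZl ?Rintegral_coordB ?mulr0//; exact: integrable_coordB.
have qdE i j : \int[L]_(y in eball x r) qd i j y =
    (i == j)%:R * (A i j * (r ^+ 2 / (2 * (n%:R + 2)) * vol x r)).
  rewrite RintegralZl//; last exact: integrable_coordM.
  by rewrite Rintegral_coordM//; field.
under eq_Rintegral do rewrite PE.
rewrite RintegralD//; last exact: integrable_EFinD.
rewrite RintegralD// Rintegral_cst// !Rintegral_sum//.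
rewrite big1 // add0r (eq_bigr (fun i => A i i * (r ^+ 2 / (2 * (n%:R + 2)) * vol x r))).
  by rewrite -mulr_suml -/(vol x r) /mxtrace; field.
move=> i _; rewrite Rintegral_sum// (bigD1 i)//= big1 => [|j ji].
  by rewrite qdE eqxx mul1r addr0.
by rewrite qdE eq_sym (negbTE ji) mul0r.
Qed.

(** A function that is uniformly M-close to a quadratic polynomial on the ball has
    a mean that is M-close to the mean of the polynomial. *)
Lemma ball_mean_quadratic x r (c M : R) (b : 'I_n -> R) (A : 'M[R]_n)
    (f : 'rV[R]_n -> R) : 0 < r -> measurable_fun (eball x r) f ->
  (forall y, eball x r y ->
    `|f y - (c + (\sum_i b i * (y ord0 i - x ord0 i) + quad A (y - x) / 2))| <= M) ->
  `|ball_mean x r f - (c + \tr A * r ^+ 2 / (2 * (n%:R + 2)))| <= M.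
Proof.
move=> r0 mf fM; have mE := measurable_eball x r0.
have [] := Rintegral_quadratic x c b A r0.
set P := fun y => _; move=> mP intP PE.
have V0 := vol_gt0 x r0.
have intfP : L.-integrable (eball x r) (EFin \o (fun y => f y - P y)).
  apply: (integrable_eball (M := M) r0) => //.
  by apply: measurable_funB => //; exact: measurable_funTS.
have intf : L.-integrable (eball x r) (EFin \o f).
  rewrite (_ : f = fun y => (f y - P y) + P y); first exact: integrable_EFinD.
  by apply/funext => y; rewrite subrK.
have -> : ball_mean x r f - (c + \tr A * r ^+ 2 / (2 * (n%:R + 2))) =
    (vol x r)^-1 * \int[L]_(y in eball x r) (f y - P y).
  rewrite RintegralB// PE mulrBr mulKf ?gt_eqF//.
rewrite normrM gtr0_norm ?invr_gt0// ler_pdivrMl//.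
apply: le_trans (le_normr_Rintegral mE intfP) _.
have -> : vol x r * M = \int[L]_(y in eball x r) M.
  by rewrite Rintegral_cst// mulrC.
apply: le_Rintegral => //.
- exact: integrable_norm.
- have M0 : 0 <= M.
    apply: le_trans (fM x _); first exact: normr_ge0.
    by rewrite eballE//= /sqdist big1 ?exprn_gt0// => i _; rewrite subrr expr0n.
  by apply: (integrable_eball (M := M) r0) => // y _; rewrite ger0_norm.
Qed.

End mean_value.

(** * Expansion of the function near a point *)

Lemma continuous_slice (R : realType) (V : normedModType R) (f : V * R -> R) y s :
  {for (y, s), continuous f} -> {for y, continuous (fun w => f (w, s))}.
Proof.
move=> cf B /cf /nbhs_ballP[r /= r0 rB]; apply/nbhs_ballP; exists r => // w yw.
by apply: rB; split => //=; exact: ballxx.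
Qed.

Lemma time_expansion (R : realType) (g : R -> R) (t k : R) : derivable g t 1 -> 0 < k ->
  \forall e \near (0 : R)^'+, `|g (t - e ^+ 2) - (g t - e ^+ 2 * derive1 g t)| <= k * e ^+ 2.
Proof.
move=> dg k0; rewrite derive1E.
have /cvgrPdist_le/(_ k k0) :
    h^-1 *: ((g \o shift t) (h *: (1 : R)) - g t) @[h --> 0^'] --> 'D_1 g t.
  exact: dg.
move=> /nbhs_ballP[r /= r0 rg].
near=> e.
have e0 : 0 < e by near: e; exact: nbhs_right_gt.
have e1 : e < 1 by near: e; exact: nbhs_right_lt.
have er : e < r by near: e; exact: nbhs_right_lt.
have e20 : 0 < e ^+ 2 by exact: exprn_gt0.
have := rg (- e ^+ 2).
rewrite -ball_normE/= sub0r opprK gtr0_norm// oppr_eq0 gt_eqF// => /(_ _ isT).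
have -> : - e ^+ 2 *: (1 : R) + t = t - e ^+ 2 by rewrite [_ *: _]mulr1 addrC.
have -> : e ^+ 2 < r by apply: lt_trans er; rewrite expr2 gtr_pMr.
move=> /(_ isT) H.
have -> : g (t - e ^+ 2) - (g t - e ^+ 2 * 'D_1 g t) =
    e ^+ 2 * ('D_1 g t - (- e ^+ 2)^-1 *: (g (t - e ^+ 2) - g t)).
  by rewrite /GRing.scale/=; field; rewrite ?oppr_eq0 gt_eqF.
by rewrite normrM gtr0_norm// mulrC ler_wpM2r// ltW.
Unshelve. all: by end_near.
Qed.

Lemma hessianE (R : realType) n (v : 'rV[R]_n * R -> R) z i j :
  hessian v z i j = partial_x j (partial_x i v) z.
Proof. by rewrite mxE. Qed.

Lemma open_cylinder (R : realType) n (T : R) (Omega : set 'rV[R]_n) :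
  open Omega -> open (Omega `*` `]0, T[%classic).
Proof.
move=> oOmega; rewrite openE => -[y s] [/= Oy sT].
exists (Omega, `]0, T[%classic) => //; split => /=.
  exact: open_nbhs_nbhs.
by apply: open_nbhs_nbhs; split => //; exact: interval_open.
Qed.

Section parabolic_expansion.
Variables (R : realType) (n : nat) (T : R) (Omega : set 'rV[R]_n).
Variable v : 'rV[R]_n * R -> R.
Hypotheses (oOmega : open Omega) (v_C21 : C21 (Omega `*` `]0, T[%classic) v).
Local Notation Q := (Omega `*` `]0, T[%classic).

Let oQ : open Q := open_cylinder oOmega.

Let contQ (f : 'rV[R]_n * R -> R) z : {within Q, continuous f} -> Q z ->
  {for z, continuous f}.
Proof. by rewrite continuous_open_subspace// => cf Qz; apply: cf; exact: mem_set. Qed.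

Lemma slice_C2_derivatives s : 0 < s < T ->
  C2_derivatives Omega (fun y => v (y, s)) (fun i y => partial_x i v (y, s))
    (fun i j y => partial_x j (partial_x i v) (y, s)).
Proof.
move=> s0T; have [_ _ v1 v2] := v_C21.
have Qs y : Omega y -> Q (y, s) by move=> Oy; split => //=; rewrite in_itv.
split => //.
- by move=> y i /Qs Qy; apply/derivableP; exact: (v1 i).1 _ Qy.
- by move=> y i j /Qs Qy; apply/derivableP; exact: (v2 i j).1 _ Qy.
- by move=> y i /Qs Qy; apply: continuous_slice; exact: contQ (v1 i).2 Qy.
- by move=> y i j /Qs Qy; apply: continuous_slice; exact: contQ (v2 i j).2 Qy.
Qed.

Lemma hessian_sym z : Q z -> (hessian v z)^T = hessian v z.
Proof.
case: z => x t [/= Ox]; rewrite in_itv/= => t0T.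
apply/matrixP => i j; rewrite !mxE.
exact: (second_partials_sym _ _ (slice_C2_derivatives t0T) Ox).
Qed.

(** Taylor's formula at time t - e^2 has its second derivatives at a point of the
    parabolic neighbourhood |y - x| <= e, |s - t| <= e^2 of (x, t), where they
    differ little from those at (x, t); this makes the remainder uniform in h.
    The hypothesis on h bounds its coordinates, so it covers the Euclidean ball
    of radius e. *)
Lemma space_expansion x (t k : R) : Q (x, t) -> 0 < k ->
  \forall e \near (0 : R)^'+, 0 < t - e ^+ 2 < T /\
    forall h : 'rV[R]_n, (forall i, `|h ord0 i| <= e) -> Omega (x + h) /\
      `|v (x + h, t - e ^+ 2) - (v (x, t - e ^+ 2) +
        (\sum_i partial_x i v (x, t - e ^+ 2) * h ord0 i +
         quad (hessian v (x, t)) h / 2))| <= k * e ^+ 2.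
Proof.
move=> Qxt k0; have [_ _ _ v2] := v_C21.
(* The n^2 entries of the Hessian each contribute an error k' e^2; adding 1
   keeps the denominator positive for every n. *)
pose k' := k / (n%:R ^+ 2 + 1).
have n1 : 0 < n%:R ^+ 2 + 1 :> R by rewrite ltr_wpDl// exprn_ge0.
have k'0 : 0 < k' by exact: divr_gt0.
have Hij (ij : 'I_n * 'I_n) : \forall z \near (x, t),
    `|hessian v (x, t) ij.1 ij.2 - hessian v z ij.1 ij.2| <= k'.
  have /cvgrPdist_le/(_ _ k'0) := contQ (v2 ij.1 ij.2).2 Qxt.
  by rewrite -hessianE; apply: filterS => z; rewrite -hessianE.
have /nbhs_ballP[r /= r0 rQ] : nbhs (x, t) (Q `&` [set z |
    forall ij : 'I_n * 'I_n,
      `|hessian v (x, t) ij.1 ij.2 - hessian v z ij.1 ij.2| <= k']).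
  by apply: filterI; [exact: open_nbhs_nbhs|exact: (filter_forall _ Hij)].
near=> e.
have e0 : 0 < e by near: e; exact: nbhs_right_gt.
have e1 : e < 1 by near: e; exact: nbhs_right_lt.
have er : e < r by near: e; exact: nbhs_right_lt.
have e2r : e ^+ 2 < r by apply: lt_trans er; rewrite expr2 gtr_pMr.
have inQ (h : 'rV[R]_n) : (forall i, `|h ord0 i| <= e) -> ball (x, t) r (x + h, t - e ^+ 2).
  move=> he; split => /=.
    split => // i j; rewrite (ord1 i) !mxE -ball_normE/= opprD addNKr normrN.
    exact: le_lt_trans (he j) er.
  by rewrite -ball_normE/= opprB addrC subrK gtr0_norm// exprn_gt0.
have sT : 0 < t - e ^+ 2 < T.
  have [|[_ +] _] := rQ _ (inQ 0 _); last by rewrite /= in_itv.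
  by move=> i; rewrite mxE normr0 ltW.
split => // h he; split; first by have [[]] := rQ _ (inQ h he).
have seg (s : R) : 0 <= s <= 1 -> ball (x, t) r (x + s *: h, t - e ^+ 2).
  move=> /andP[s0 s1]; apply: inQ => i; rewrite mxE normrM ger0_norm//.
  by apply: le_trans (he i); rewrite ler_piMl.
have [|s s01] := taylor2 (x := x) (h := h) (slice_C2_derivatives sT).
  by move=> s /seg /rQ[[]].
pose H s := hessian v (x + s *: h, t - e ^+ 2).
rewrite -/(H s) (eq_bigr (fun i => partial_x i v (x, t - e ^+ 2) * h ord0 i));
  last by move=> i _; rewrite mulrC.
set q := quad (H s) h => ->; set q0 := quad (hessian v (x, t)) h.
set S := \sum_(i < n) _; set v0 := v _.
have -> : v0 + S + q / 2 - (v0 + (S + q0 / 2)) = (q - q0) / 2 by field.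
have : `|q - q0| <= n%:R ^+ 2 * k' * e ^+ 2.
  apply: quad_dist => //; first exact: ltW.
  by move=> i j; rewrite distrC; have [_ /(_ (i, j))] := rQ _ (seg _ s01).
have : n%:R ^+ 2 * k' * e ^+ 2 <= k * e ^+ 2.
  rewrite ler_wpM2r ?sqr_ge0// /k' mulrA ler_pdivrMr// mulrC ler_wpM2l ?(ltW k0)//.
  by rewrite lerDl.
by rewrite normrM [`|2^-1|]gtr0_norm//; have := normr_ge0 (q - q0); lra.
Unshelve. all: by end_near.
Qed.

End parabolic_expansion.

(** A uniform error M on g becomes an error M on its supremum, provided that the
    comparison function q attains its supremum l. *)
Lemma sup_approx (R : realType) (T : Type) (S : set T) (g q : T -> R) (l M : R) :
  (forall z, S z -> `|g z - q z| <= M) -> (forall z, S z -> q z <= l) ->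
  (exists2 z, S z & q z = l) -> `|sup (g @` S) - l| <= M.
Proof.
move=> gq ql [z Sz qz].
have ubg : ubound (g @` S) (l + M).
  move=> _ [w Sw <-]; have := gq _ Sw; have := ql _ Sw.
  by rewrite ler_norml => ? /andP[? ?]; lra.
have h1 : sup (g @` S) <= l + M by apply: ge_sup ubg; exists (g z), z.
have h2 : g z <= sup (g @` S) by apply: ub_le_sup; [exists (l + M)|exists z].
have := gq _ Sz; rewrite qz !ler_norml => /andP[? ?]; lra.
Qed.

(** * The asymptotic mean value property *)

Theorem theorem2p1 (R : realType) (n : nat) (p T : R)
    (Omega : set 'rV[R]_n) (v : 'rV[R]_n * R -> R)
    (n_gt0 : (0 < n)%N) (p_gt2 : 2 < p) (T_gt0 : 0 < T)
    (Omega_domain : domain Omega) (Omega_bounded : bounded_set Omega)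
    (Omega_sphere : uniform_exterior_sphere Omega)
    (v_C21 : C21 (Omega `*` `]0, T[%classic) v)
    (x : 'rV[R]_n) (t : R) (xt_in : (Omega `*` `]0, T[%classic) (x, t)) :
  (fun eps : R =>
     (n%:R + 2) / (p + n%:R) * ball_mean x eps (fun y => v (y, t - eps ^+ 2)) +
     (p - 2) / (p + n%:R) *
       sup [set (v (x + eps *: sigma, t - eps ^+ 2) +
                 v (x - eps *: sigma, t - eps ^+ 2)) / 2
           | sigma in @usphere R n])
  = (fun eps : R =>
       v (x, t) +
       eps ^+ 2 / (2 * (n%:R + p)) *
         (dominative_pLaplacian p v (x, t) -
          2 * (n%:R + p) * partial_t v (x, t)))
    +o_ (0^'+) (fun eps : R => eps ^+ 2).
Proof.
have [Ox t0T] := xt_in; have [oOmega _ _] := Omega_domain.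
have symH := hessian_sym oOmega v_C21 xt_in.
set H := hessian v (x, t) in symH.
set lam := (eigenvalues H)`_n.-1.
have [plapE lam_ub lam_max] := dominative_quad p n_gt0 symH.
have pn0 : 0 < p + n%:R by rewrite ltr_wpDr// (lt_trans _ p_gt2).
have n20 : 0 < n%:R + 2 :> R by rewrite ltr_wpDl.
have vt : derivable (fun s => v (x, s)) t 1.
  by have [_ [vt _] _ _] := v_C21; exact: vt _ xt_in.
apply/eqaddoP => k k0; have k20 : 0 < k / 2 by rewrite divr_gt0.
near=> e.
have e0 : 0 < e by near: e; exact: nbhs_right_gt.
have [sT spaceE] : 0 < t - e ^+ 2 < T /\
    forall h : 'rV[R]_n, (forall i, `|h ord0 i| <= e) -> Omega (x + h) /\
      `|v (x + h, t - e ^+ 2) - (v (x, t - e ^+ 2) +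
        (\sum_i partial_x i v (x, t - e ^+ 2) * h ord0 i + quad H h / 2))|
      <= k / 2 * e ^+ 2.
  by near: e; exact: space_expansion.
have timeE : `|v (x, t - e ^+ 2) - (v (x, t) - e ^+ 2 * partial_t v (x, t))| <= k / 2 * e ^+ 2.
  by near: e; exact: time_expansion.
set s := t - e ^+ 2 in sT spaceE timeE *.
have meanE : `|ball_mean x e (fun y => v (y, s)) -
    (v (x, s) + \tr H * e ^+ 2 / (2 * (n%:R + 2)))| <= k / 2 * e ^+ 2.
  have yE y : eball x e y -> Omega y /\
      `|v (y, s) - (v (x, s) + (\sum_i partial_x i v (x, s) * (y ord0 i - x ord0 i) +
        quad H (y - x) / 2))| <= k / 2 * e ^+ 2.
    move=> Ey; have [|] := spaceE (y - x).
      by move=> i; rewrite !mxE; exact: coord_le_eball.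
    rewrite (addrC x) subrK => Oy yE; split => //; move: yE.
    by under eq_bigr do rewrite !mxE.
  apply: (@ball_mean_quadratic _ _ _ _ _ _ (fun i => partial_x i v (x, s)) H _ e0)
    => [|y /yE[]//].
  apply: (@measurable_funS _ _ _ _ Omega).
  - exact: open_measurable_rV.
  - by move=> y /yE[].
  apply: continuous_measurable_rV => // y Oy.
  apply: continuous_slice; have [cv _ _ _] := v_C21.
  move: cv; rewrite continuous_open_subspace.
    by apply; apply/mem_set; split => //=; rewrite in_itv.
  exact: open_cylinder.
have supE : `|sup [set (v (x + e *: sigma, s) + v (x - e *: sigma, s)) / 2
      | sigma in @usphere R n] - (v (x, s) + e ^+ 2 * lam / 2)| <= k / 2 * e ^+ 2.
  apply: (@sup_approx _ _ _ _ (fun sigma => v (x, s) + e ^+ 2 * quad H sigma / 2)).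
  (* The expansions for h and - h are averaged: their linear terms cancel. *)
  - move=> sg usg.
    have he i : `|(e *: sg) ord0 i| <= e.
      rewrite mxE normrM gtr0_norm// ler_piMr ?(ltW e0)//.
      rewrite -(@ler_pXn2r _ 2%N) ?nnegrE// real_normK ?num_real// expr1n.
      rewrite -(usphere_sum_sqr usg) (bigD1 i)//= lerDl sumr_ge0// => j _.
      exact: sqr_ge0.
    have [_] := spaceE _ he.
    have [|_] := spaceE (- (e *: sg)); first by move=> i; rewrite mxE normrN.
    rewrite (_ : quad H (- (e *: sg)) = e ^+ 2 * quad H sg); last first.
      by rewrite -scaleNr quadZ sqrrN.
    rewrite quadZ (_ : \sum_i _ * (- (e *: sg)) ord0 i =
        - \sum_i partial_x i v (x, s) * (e *: sg) ord0 i); last first.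
      by rewrite -sumrN; apply: eq_bigr => i _; rewrite [X in _ * X]mxE mulrN.
    set S := \sum_i _.
    by rewrite !ler_norml => /andP[? ?] /andP[? ?]; apply/andP; split; lra.
  - move=> sg usg; rewrite lerD2l ler_wpM2r// ler_wpM2l ?sqr_ge0//; exact: lam_ub.
  - by have [sg usg E] := lam_max; exists sg => //; rewrite E.
rewrite !fctE (_ : dominative_pLaplacian p v (x, t) = \tr H + (p - 2) * lam) //.
set m := ball_mean _ _ _ in meanE *; set S := sup _ in supE *.
(* The total error is the weighted average of the errors of the mean and of the
   supremum, plus the error of the expansion in time. *)
have -> : (n%:R + 2) / (p + n%:R) * m + (p - 2) / (p + n%:R) * S -
    (v (x, t) + e ^+ 2 / (2 * (n%:R + p)) *
      (\tr H + (p - 2) * lam - 2 * (n%:R + p) * partial_t v (x, t))) =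
    (n%:R + 2) / (p + n%:R) * (m - (v (x, s) + \tr H * e ^+ 2 / (2 * (n%:R + 2)))) +
    (p - 2) / (p + n%:R) * (S - (v (x, s) + e ^+ 2 * lam / 2)) +
    (v (x, s) - (v (x, t) - e ^+ 2 * partial_t v (x, t))).
  by field; rewrite !gt_eqF.
rewrite (ger0_norm (sqr_ge0 e)).
have -> : k * e ^+ 2 = (n%:R + 2) / (p + n%:R) * (k / 2 * e ^+ 2) +
    (p - 2) / (p + n%:R) * (k / 2 * e ^+ 2) + k / 2 * e ^+ 2.
  by field; rewrite gt_eqF.
apply: le_trans (ler_normD _ _) _; apply: lerD => //.
apply: le_trans (ler_normD _ _) _; apply: lerD; rewrite normrM ger0_norm.
- by apply: ler_wpM2l => //; rewrite divr_ge0// ltW.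
- by rewrite divr_ge0// ltW.
- by apply: ler_wpM2l => //; rewrite divr_ge0 ?subr_ge0// ltW.
- by rewrite divr_ge0 ?subr_ge0// ltW.
Unshelve. all: by end_near.
Qed.
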